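(* Let $\Omega\subset\mathbb{R}^d$ be a nonempty open set of finite measure, $L\in(0,1)$, $\varepsilon>0$, and let $A$ generate a $C_0$ semigroup $(S_t)_{t\ge0}$ on $L^2(\Omega)$. Let $y_0=0$ and $y_f\in L^2(\Omega)$ with $y_f\ge0$ and $\|y_f\|_{L^2}>\varepsilon$. Assume that $A^\ast$ satisfies the comparison principle: for all $y\in L^2(\Omega)$, $y\ge0$ implies $S_t^\ast y\ge0$ for all $t>0$. With $\Pi$, $T^\star$, $T_\ell$, $\mu_-$ as defined in the context: (1) for all $T\in(0,T_\ell)$, any optimal control for the problem defining $\Pi(T)$ is a minimal time control, that is, $T^\star(\Pi(T))=T$; (2) for any $\lambda>\mu_-$, $\Pi(T^\star(\lambda))=\lambda$.
   Context: For $T>0$: $E_T=L^2((0,T)\times\Omega)$, $L_Tu=\int_0^TS_{T-t}u(t)\,dt$ for $u\in E_T$, and $$F_T(u)=\frac12\operatorname*{ess\,sup}_{t\in(0,T)}\max\Big(\|u(t)\|_{L^\infty(\Omega)},\frac{\|u(t)\|_{L^1(\Omega)}}{L|\Omega|}\Big)^2+\delta_{\{u\ge0\}}(u),$$ where $\delta_{\{u\ge0\}}(u)=0$ if $u\ge0$ a.e. and $+\infty$ otherwise. Value function (with $y_0=0$): $\Pi(T)=\frac12\overline M(T)^2=\inf\{F_T(u):\ u\in E_T,\ \|L_Tu-y_f\|_{L^2}\le\varepsilon\}$, with $\overline M(T)\ge0$. Minimal time: for $\lambda>0$, $T^\star(\lambda)=\inf\{T>0:\ \exists u\in E_T,\ \|L_Tu-y_f\|_{L^2}\le\varepsilon,\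 F_T(u)\le\lambda\}$. Under the stated hypotheses $\Pi$ is finite and non-increasing on $(0,+\infty)$, and $\mu_-=\lim_{T\to+\infty}\Pi(T)\in[0,+\infty)$. $T_\ell\in(0,+\infty]$ denotes the (unique) element such that $\overline M$ (equivalently $\Pi$) is strictly decreasing on $(0,T_\ell)$ and constant on $[T_\ell,+\infty)$ (the latter being void if $T_\ell=+\infty$); such a $T_\ell$ exists under the stated hypotheses. *)

(* Defs.v *)
From HB Require Import structures.
From mathcomp Require Import all_boot all_order all_algebra.
From mathcomp Require Import all_classical all_reals all_analysis.
From mathcomp Require Import ess_sup_inf.

Set Implicit Arguments.
Unset Strict Implicit.
Unset Printing Implicit Defensive.
Import Order.TTheory GRing.Theory Num.Theory.
Import numFieldTopology.Exports numFieldNormedType.Exports.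

Local Open Scope classical_set_scope.
Local Open Scope ring_scope.

(** * Lebesgue measure on [R^d]

    [R^d] is ['rV[R]_d] with its Borel sigma-algebra.  Lebesgue measure is the
    iterated product of the one-dimensional Lebesgue measure, transported along
    [R * R^d ~ R^(1+d)]; in dimension 0 it is the unit mass. *)

Notation borel_rV R d := (g_sigma_algebraType (@open 'rV[R]_d)).

Section lebesgue_rV.
Variable R : realType.

Definition rV_cons d (x : measurableTypeR R * borel_rV R d) :
    borel_rV R d.+1 :=
  \row_j oapp ((x.2 : 'rV[R]_d) ord0) x.1 (unlift ord0 j).

Definition rV_uncons d (v : borel_rV R d.+1) :
    measurableTypeR R * borel_rV R d :=
  ((v : 'rV[R]_d.+1) ord0 ord0, \row_j (v : 'rV[R]_d.+1) ord0 (lift ord0 j)).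

Lemma rV_consK d : cancel (@rV_cons d) (@rV_uncons d).
Proof.
move=> [x v]; rewrite /rV_uncons /rV_cons mxE unlift_none/=; congr pair.
by apply/rowP => j; rewrite !mxE liftK.
Qed.

Lemma rV_cons_continuous d :
  continuous (@rV_cons d : R * 'rV[R]_d -> 'rV[R]_d.+1).
Proof.
move=> [x v] A [P nP PA].
exists (P ord0 ord0, [set w : 'rV[R]_d | forall j, P ord0 (lift ord0 j) (w ord0 j)]).
  split => /=.
    by have := nP ord0 ord0; rewrite mxE unlift_none.
  exists (fun _ j => P ord0 (lift ord0 j)).
    by move=> i j; rewrite ord1; have := nP ord0 (lift ord0 j); rewrite mxE liftK.
  by move=> w h j; apply: h.
move=> [y w] [/= Py Pw]; apply: PA => i j; rewrite ord1 mxE.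
by case: unliftP => [k|] ->.
Qed.

(* Only the first factor needs a countable base. *)
Lemma open_measurable_prod d (U : set (R * 'rV[R]_d)) : open U ->
  measurable (U : set (measurableTypeR R * borel_rV R d)).
Proof.
move=> oU.
pose I (q : rat * rat) : set R := [set` `](ratr q.1), (ratr q.2)[].
pose V (q : rat * rat) : set 'rV[R]_d :=
  [set w | forall y, I q y -> U (y, w)]^°.
have -> : U = \bigcup_(q in [set: rat * rat]) (I q `*` V q).
  apply/seteqP; split => [[x v] Uxv|[x v] [q _] [/= xq Vv]]; last first.
    by have := interior_subset Vv; apply.
  have : nbhs (x, v) U by exact: open_nbhs_nbhs.
  move=> [[A B] [/= nA nB] AB].
  have /nbhs_ballP[e /= e0 eA] := nA.
  have [q1] : exists q : rat, ratr q \in `]x - e, x[.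
    by apply: rat_in_itvoo; rewrite ltrBlDr ltrDl.
  rewrite in_itv/= => /andP[q1l q1r].
  have [q2] : exists q : rat, ratr q \in `]x, x + e[.
    by apply: rat_in_itvoo; rewrite ltrDl.
  rewrite in_itv/= => /andP[q2l q2r].
  exists (q1, q2) => //; split => /=; first by rewrite /I/= in_itv/= q1r.
  apply: filterS nB => w Bw y; rewrite /I/= in_itv/= => /andP[yl yr].
  apply: (AB (y, w)); split => //=; apply: eA.
  rewrite /ball/= distrC ltr_distl.
  by rewrite (lt_trans q1l)// (lt_trans yr).
apply: countable_bigcupT_measurable => [|q]; first exact: countableP.
apply: measurableX; first exact: measurable_itv.
by apply: sub_sigma_algebra; exact: open_interior.
Qed.

Lemma measurable_rV_cons d : measurable_fun setT (@rV_cons d).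
Proof.
apply: (@measurability _ _ _ (borel_rV R d.+1) _ _ (@open 'rV[R]_d.+1)) => //.
move=> _ [U oU <-]; rewrite setTI; apply: open_measurable_prod.
by move: oU; apply: open_comp => x _; exact: rV_cons_continuous.
Qed.

Lemma measurable_rV_uncons d : measurable_fun setT (@rV_uncons d).
Proof.
apply: measurable_fun_pair.
  apply: (measurability _ (measurable_realfun.RGenOpens.measurableE R)).
  move=> _ [_ [a [b ->] <-]]; rewrite setTI; apply: sub_sigma_algebra.
  apply: (@open_comp 'rV[R]_d.+1 R (fun v => v ord0 ord0)).
    by move=> v _; exact: coord_continuous.
  exact: interval_open.
apply: (@measurability _ _ _ (borel_rV R d) _ _ (@open 'rV[R]_d)) => //.
move=> _ [U oU <-]; rewrite setTI; apply: sub_sigma_algebra.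
apply: (@open_comp 'rV[R]_d.+1 'rV[R]_d
  (fun v => \row_j v ord0 (lift ord0 j))) oU => v _ A [P nP PA].
exists (fun _ k => oapp (P ord0) setT (unlift ord0 k)).
  move=> i k; rewrite ord1; case: unliftP => [j ->|_]/=; last exact: filterT.
  by have := nP ord0 j; rewrite mxE.
move=> w Pw; apply: PA => i j; rewrite ord1 mxE.
by have := Pw ord0 (lift ord0 j); rewrite liftK.
Qed.

Section step.
Variables (d : nat) (m : {sigma_finite_measure set (borel_rV R d) -> \bar R}).

Definition lebesgue_rVS :=
  pushforward (@lebesgue_measure R \x m)%E (@rV_cons d).

Let pushforward_measure : {measure set (borel_rV R d.+1) -> \bar R} :=
  @measure_function_pushforward__canonical__measure_function_Measure _ _ _ _ _
    (@lebesgue_measure R \x m)%E _ (@measurable_rV_cons d).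

HB.instance Definition _ := isMeasure.Build _ _ _ lebesgue_rVS
  (measure0 pushforward_measure) (measure_ge0 pushforward_measure)
  (@measure_semi_sigma_additive _ _ _ pushforward_measure).

Let lebesgue_rVS_sigma_finite : sigma_finite setT lebesgue_rVS.
Proof.
have /sigma_finiteP[F [TF ndF Foo]] := sigma_finiteT (@lebesgue_measure R).
have /sigma_finiteP[G [TG ndG Goo]] := sigma_finiteT m.
exists (fun n => @rV_uncons d @^-1` (F n `*` G n)).
  apply/seteqP; split => // v _; rewrite /bigcup/=.
  have : setT (rV_uncons v).1 by []. rewrite TF => -[i _ Fi].
  have : setT (rV_uncons v).2 by []. rewrite TG => -[j _ Gj].
  exists (maxn i j) => //; split.
    by move: Fi; exact/subsetPset/ndF/leq_maxl.
  by move: Gj; exact/subsetPset/ndG/leq_maxr.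
move=> n; have [mF Fn] := Foo n; have [mG Gn] := Goo n; split.
  rewrite -[X in measurable X]setTI.
  by apply: measurable_rV_uncons => //; exact: measurableX.
rewrite /lebesgue_rVS /pushforward -comp_preimage.
rewrite (_ : _ \o _ = id); last by apply/funext => x /=; rewrite rV_consK.
by rewrite preimage_id product_measure1E// lte_mul_pinfty// ge0_fin_numE.
Qed.

HB.instance Definition _ := Measure_isSigmaFinite.Build _ _ _ lebesgue_rVS
  lebesgue_rVS_sigma_finite.

End step.

Fixpoint lebesgue_rV d : {sigma_finite_measure set (borel_rV R d) -> \bar R} :=
  if d is d'.+1 then lebesgue_rVS (lebesgue_rV d')
  else \d_((0 : 'rV[R]_0) : borel_rV R 0).

Lemma lebesgue_rV_box d (a b : 'rV[R]_d) :
  (forall i, a ord0 i <= b ord0 i) ->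
  let B := [set v : 'rV[R]_d | forall i, v ord0 i \in `[a ord0 i, b ord0 i]] in
  measurable (B : set (borel_rV R d)) /\
  lebesgue_rV d B = (\prod_i (b ord0 i - a ord0 i))%:E.
Proof.
elim: d a b => [|d IH] a b ab B.
  have -> : B = setT by apply/seteqP; split=> // v _ -[].
  by rewrite big_ord0 /= diracT.
pose ta : 'rV[R]_d := \row_j a ord0 (lift ord0 j).
pose tb : 'rV[R]_d := \row_j b ord0 (lift ord0 j).
have [|mC lC] := IH ta tb; first by move=> i; rewrite !mxE.
set C := (X in lebesgue_rV _ X) in lC; rewrite -/C in mC.
pose I : set (measurableTypeR R) := [set` `[a ord0 ord0, b ord0 ord0]].
have mI : measurable I by exact: measurable_itv.
have BE : B = @rV_uncons d @^-1` (I `*` C).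
  apply/seteqP; split => [v Bv|v [Iv Cv] i].
    by split=> [|j]; rewrite ?mxE; exact: Bv.
  case: (unliftP ord0 i) => [j|] -> //.
  by have := Cv j; rewrite !mxE.
split.
  rewrite BE -[X in measurable X]setTI.
  by apply: measurable_rV_uncons => //; exact: measurableX.
rewrite BE /= /lebesgue_rVS /pushforward -comp_preimage.
rewrite (_ : _ \o _ = id); last by apply/funext => x /=; rewrite rV_consK.
rewrite preimage_id product_measure1E//.
have /= := lebesgue_measure_itv `[a ord0 ord0, b ord0 ord0].
rewrite -/I lte_fin => lI; etransitivity; first exact: congr2 lI lC.
rewrite big_ord_recl; case: ltgtP (ab ord0) => // [_ _|-> _].
  by rewrite EFinM; congr (_ * _%:E)%E; apply: eq_bigr => i _; rewrite !mxE.
by rewrite mul0e subrr mul0r.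
Qed.

Definition lebesgue_on d (Omega : set 'rV[R]_d) (oO : open Omega)
    (fO : (lebesgue_rV d Omega < +oo)%E) :
    {finite_measure set (borel_rV R d) -> \bar R} :=
  mfrestr (sub_sigma_algebra oO : measurable (Omega : set (borel_rV R d))) fO.

End lebesgue_rV.

(** * L^2 and C_0 semigroups

    An element of [L2 mu] is a square-integrable function.  Equality in the
    Hilbert space L^2 is [L2eq]; operators are maps between
    representatives that respect it and whose laws hold a.e. *)

Section L2.
Context (R : realType) d (X : measurableType d).
Variable mu : {finite_measure set X -> \bar R}.

Definition L2 := LfunType mu (lee1n 2).

Definition L2eq (f g : L2) : Prop := (f : X -> R) = g %[ae mu].

Definition L2norm (f : L2) : \bar R := 'N[mu]_2%:E[EFin \o f].

Definition L2dot (f g : L2) : R := \int[mu]_x (f x * g x).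

Definition L2nneg (f : L2) : Prop := {ae mu, forall x, 0 <= f x}.

Record C0_semigroup (S : R -> L2 -> L2) : Prop := {
  C0_ae : forall (t : R) f g, 0 <= t -> L2eq f g -> L2eq (S t f) (S t g) ;
  C0_linear : forall (t a : R) (f g : L2), 0 <= t ->
    L2eq (S t (a *: f + g)) (a *: S t f + S t g) ;
  C0_bounded : forall t : R, 0 <= t ->
    exists C : R, forall f, (L2norm (S t f) <= C%:E * L2norm f)%E ;
  C0_id : forall f, L2eq (S 0 f) f ;
  C0_comp : forall (t s : R) f, 0 <= t -> 0 <= s ->
    L2eq (S (t + s) f) (S t (S s f)) ;
  C0_cvg : forall f, L2norm (S t f - f) @[t --> 0^'+] --> 0%E }.

(* An unbounded operator [A] is given by its graph: [A f g] holds iff [f] is in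
   the domain of [A] and [A f = g]. *)
Definition generates (A : L2 -> L2 -> Prop) (S : R -> L2 -> L2) : Prop :=
  C0_semigroup S /\
  forall f g, A f g <->
    L2norm (h^-1 *: (S h f - f) - g) @[h --> 0^'+] --> 0%E.

Definition adjoint (P Q : L2 -> L2) : Prop :=
  forall f g, L2dot (P f) g = L2dot f (Q g).

Definition comparison_principle (S : R -> L2 -> L2) : Prop :=
  forall y, L2nneg y -> forall t : R, 0 < t -> L2nneg (S t y).

End L2.

(** * Bochner integral of L^2-valued functions

    The list [[:: (A1, f1); ...; (Ak, fk)]] stands for the simple function
    [t |-> \1_A1 t *: f1 + ... + \1_Ak t *: fk]. *)

Section bochner.
Context (R : realType) d (X : measurableType d).
Variable mu : {finite_measure set X -> \bar R}.
Context d' (Y : measurableType d').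
Variable nu : {measure set Y -> \bar R}.

Definition L2simple (s : seq (set Y * L2 mu)) (t : Y) : L2 mu :=
  \sum_(p <- s) (\1_p.1 t : R) *: p.2.

Definition L2simple_integral (s : seq (set Y * L2 mu)) : L2 mu :=
  \sum_(p <- s) fine (nu p.1) *: p.2.

Definition is_bochner (g : Y -> L2 mu) (w : L2 mu) : Prop :=
  exists s : nat -> seq (set Y * L2 mu),
  [/\ forall n p, p \in s n -> measurable p.1 /\ (nu p.1 < +oo)%E,
      {ae nu, forall t, L2norm (g t - L2simple (s n) t) @[n --> \oo] --> 0%E},
      (\int[nu]_t L2norm (g t - L2simple (s n) t)%R)%E @[n --> \oo] --> 0%E
    & L2norm (L2simple_integral (s n) - w) @[n --> \oo] --> 0%E ].

(* Equal to 0 when [g] is not Bochner integrable. *)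
Definition bochner (g : Y -> L2 mu) : L2 mu := xget 0 (is_bochner g).

End bochner.

(** * The control problem *)

Section control.
Context (R : realType) d (X : measurableType d).
Variable mu : {finite_measure set X -> \bar R}.
Variables (S : R -> L2 mu -> L2 mu) (L eps : R) (yf : L2 mu).

Definition time_measure (T : R) : {measure set (measurableTypeR R) -> \bar R} :=
  mrestr lebesgue_measure (measurable_itv `]0, T[).

Definition controls (T : R) := LfunType (time_measure T \x mu)%E (lee1n 2).

(* [u(t)] as an element of L^2; for a.e. [t] the slice [u(t, _)] is
   square-integrable, for the other [t] it is replaced by 0. *)
Definition slice T (u : controls T) (t : R) : L2 mu :=
  insubd (0 : L2 mu) (fun x => u (t, x)).

Definition LT T (u : controls T) : L2 mu :=
  bochner (time_measure T) (fun t => S (T - t) (slice u t)).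

Definition FT T (u : controls T) : \bar R :=
  ((2^-1)%:E * ess_sup (time_measure T) (fun t =>
     (maxe 'N[mu]_+oo[(fun x => (u (t, x))%:E)]
           ('N[mu]_1[(fun x => (u (t, x))%:E)] * (L * fine (mu setT))^-1%:E)) ^+ 2)
   + (if `[< {ae (time_measure T \x mu)%E, forall z, (0 <= u z)%R} >]
      then 0 else +oo))%E.

Definition feasible T (u : controls T) : Prop :=
  (L2norm (LT u - yf)%R <= eps%:E)%E.

Definition value (T : R) : \bar R :=
  ereal_inf [set FT u | u in [set u : controls T | feasible u]].

Definition optimal T (u : controls T) : Prop := feasible u /\ FT u = value T.

Definition Tstar (lambda : \bar R) : \bar R :=
  ereal_inf [set T%:E | T in [set T | 0 < T /\
    exists u : controls T, feasible u /\ (FT u <= lambda)%E]].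

Definition minimal_time_control (lambda : \bar R) T (u : controls T) : Prop :=
  [/\ feasible u, (FT u <= lambda)%E & Tstar lambda = T%:E].

Definition is_Tell (Tl : \bar R) : Prop :=
  [/\ (0 < Tl)%E,
      forall s t : R, 0 < s -> s < t -> (t%:E < Tl)%E -> (value t < value s)%E
    & forall s t : R, (Tl <= s%:E)%E -> (Tl <= t%:E)%E -> value s = value t ].

Definition mu_minus : \bar R := lim (value T @[T --> +oo]).

End control.

(* Main.v *)
Require Import Defs.
From HB Require Import structures.
From mathcomp Require Import all_boot all_order all_algebra.
From mathcomp Require Import all_classical all_reals all_analysis.
From mathcomp Require Import measurable_realfun ess_sup_inf ring lra.

Set Implicit Arguments.
Unset Strict Implicit.
Unset Printing Implicit Defensive.
Import Order.TTheory GRing.Theory Num.Theory.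
Import numFieldTopology.Exports numFieldNormedType.Exports.

Local Open Scope classical_set_scope.
Local Open Scope ring_scope.

(** The first claim only uses the strict monotonicity of the value function: it
    excludes a control of cost at most [Pi(T)] on a shorter horizon and provides
    one on every longer horizon below [T_l].

    For the second claim put [T0 = T*(lambda)] and show that [Pi] is continuous
    at [T0], without weak compactness.  By duality the comparison principle
    makes [S_t] positive, so [0 <= u(t) <= a] gives
    [|S_(T-t) u(t)| <= a |S_(T-t) 1|], which is locally bounded in time.
    Hence dropping the initial part of length [h] of a control displaces the
    state reached by at most [a C h].  This defect is absorbed by a convex
    combination, with small weight [theta], with a control reaching the ball of
    radius [eps / 2] around [yf], and the cost changes by [O(theta)].  Such a
    control exists on every horizon: concentrate [f / dl] on the last [dl] units
    of time, where [f] is bounded, nonnegative and close to [yf]; the state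
    reached is an average of the orbit of [f], close to [f] by continuity at 0.
    The same bound shows that short horizons only reach small states, whence
    [T0 > 0]. *)

(** * The space L^2 *)

Section L2_theory.
Context (R : realType) d (X : measurableType d).
Variable mu : {finite_measure set X -> \bar R}.
Implicit Types f g h : L2 mu.

Definition nrm f : R := fine (L2norm f).

Lemma L2normE f : L2norm f = (nrm f)%:E.
Proof. by rewrite /L2norm -finite_norm_fine. Qed.

Lemma nrm_ge0 f : 0 <= nrm f.
Proof. by rewrite -lee_fin -L2normE Lnorm_ge0. Qed.

Lemma nrmD f g : nrm (f + g) <= nrm f + nrm g.
Proof. exact: ler_LnormD. Qed.

Lemma nrmZ (a : R) f : nrm (a *: f) = `|a| * nrm f.
Proof. by apply/EFin_inj; rewrite EFinM -!L2normE /L2norm -LnormZ. Qed.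

Lemma nrm0 : nrm 0 = 0.
Proof. by rewrite -(scale0r (0 : L2 mu)) nrmZ normr0 mul0r. Qed.

Lemma nrmN f : nrm (- f) = nrm f.
Proof. by rewrite -scaleN1r nrmZ normrN1 mul1r. Qed.

Lemma nrmB f g : nrm (f - g) = nrm (g - f).
Proof. by rewrite -nrmN opprB. Qed.

Lemma nrm_triangle g f h : nrm (f - h) <= nrm (f - g) + nrm (g - h).
Proof. by rewrite (le_trans _ (nrmD _ _))// addrA subrK. Qed.

Lemma nrm_le_sub f g : nrm f <= nrm g + nrm (f - g).
Proof. by rewrite (le_trans _ (nrmD _ _))// addrC subrK. Qed.

Lemma sqr_nrm f : ((nrm f ^+ 2)%:E = \int[mu]_x ((f x) ^+ 2)%:E)%E.
Proof.
rewrite -powR_mulrn ?nrm_ge0// -poweR_EFin -L2normE /L2norm poweR_Lnorm//.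
apply: eq_integral => x _ /=.
by rewrite powR_mulrn// real_normK// num_real.
Qed.

Lemma measurable_L2 f : measurable_fun setT (f : X -> R).
Proof. exact: measurable_funPT. Qed.

(** The squares of the norms are integrals, and these are monotone for inequalities that hold almost
    everywhere. *)
Lemma le_nrm f g : {ae mu, forall x, (`|f x| <= `|g x|)%R} -> nrm f <= nrm g.
Proof.
move=> fg; rewrite -(@ler_pXn2r _ 2)// ?nnegrE ?nrm_ge0//.
rewrite -lee_fin !sqr_nrm.
apply: ae_ge0_le_integral => //; try by move=> x _; rewrite lee_fin sqr_ge0.
- by apply/measurable_EFinP; apply: measurable_funX.
- by apply/measurable_EFinP; apply: measurable_funX.
- apply: filterS fg => x fg _.
  rewrite lee_fin -(real_normK (num_real (f x))) -(real_normK (num_real (g x))).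
  by rewrite ler_pXn2r// nnegrE.
Qed.

Lemma L2eq_refl f : L2eq f f.
Proof. by apply: filterS (filterT) => x. Qed.

Lemma L2eq_sym f g : L2eq f g -> L2eq g f.
Proof. by apply: filterS => x + xT => /(_ xT). Qed.

Lemma L2eq_trans g f h : L2eq f g -> L2eq g h -> L2eq f h.
Proof. by apply: filterS2 => x fg gh xT; rewrite fg// gh. Qed.

Lemma L2addE f g x : (f + g) x = f x + g x. Proof. by []. Qed.
Lemma L2oppE f x : (- f) x = - f x. Proof. by []. Qed.
Lemma L2scaleE (a : R) f x : (a *: f) x = a * f x. Proof. by []. Qed.
Lemma L2zeroE x : (0 : L2 mu) x = 0. Proof. by []. Qed.

Lemma L2eqD f g f' g' : L2eq f f' -> L2eq g g' -> L2eq (f + g) (f' + g').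
Proof. by apply: filterS2 => x ff gg xT; rewrite !L2addE ff// gg. Qed.

Lemma nrm_eq f g : L2eq f g -> nrm f = nrm g.
Proof.
move=> fg; apply/eqP; rewrite eq_le !le_nrm//; apply: filterS fg => x -> //.
Qed.

Lemma nrm_sub_eq0 f g : nrm (f - g) = 0 -> L2eq f g.
Proof.
move=> /fine_Lnormr_eq0; apply: filterS => x /= h xT.
by have /eqP := h xT; rewrite subr_eq0 => /eqP.
Qed.

Lemma L2dot_integrable f g :
  mu.-integrable setT (EFin \o (fun x => f x * g x)).
Proof.
have fg : (f \* g : X -> R) \in Lfun mu 1 by apply: Lfun2_mul_Lfun1; exact: LfunP.
by have /Lfun1_integrable := fg.
Qed.

Lemma L2dotDl f g h : L2dot (f + g) h = L2dot f h + L2dot g h.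
Proof.
rewrite /L2dot -RintegralD//; try exact: L2dot_integrable.
by apply: eq_Rintegral => x _; rewrite L2addE mulrDl.
Qed.

Lemma L2dotZl (a : R) f h : L2dot (a *: f) h = a * L2dot f h.
Proof.
rewrite /L2dot -RintegralZl//; last exact: L2dot_integrable.
by apply: eq_Rintegral => x _; rewrite L2scaleE mulrA.
Qed.

Lemma L2dot0l h : L2dot 0 h = 0.
Proof. by rewrite -(scale0r (0 : L2 mu)) L2dotZl mul0r. Qed.

Lemma L2dotff f : L2dot f f = nrm f ^+ 2.
Proof.
apply/EFin_inj; rewrite sqr_nrm /L2dot /Rintegral fineK//.
exact: integrable_fin_num (L2dot_integrable f f).
Qed.

Lemma L2_cauchy_schwarz f g : `|L2dot f g| <= nrm f * nrm g.
Proof.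
rewrite (le_trans (le_normr_Rintegral _ (L2dot_integrable f g)))//.
rewrite -lee_fin EFinM -!L2normE.
have -> : (\int[mu]_t `|f t * g t|)%:E = 'N[mu]_1[EFin \o (f \* g)%R]%E.
  rewrite Lnorm1 /Rintegral fineK//.
  apply: integrable_fin_num => //; exact: integrable_norm (L2dot_integrable f g).
by apply: hoelder; rewrite //=; lra.
Qed.

Lemma L2norm_cvg0 (T : Type) (F : set_system T) (FF : Filter F) (u : T -> L2 mu) :
  (L2norm (u n) @[n --> F] --> 0%E) <-> (nrm (u n) @[n --> F] --> 0).
Proof.
under eq_fun do rewrite L2normE.
by split => [/fine_cvgP[_]//|h]; apply: cvg_EFin => //; exact: nearW.
Qed.

End L2_theory.

(** * Lower limits and series of increments *)

Lemma limn_einf_le (R : realType) (u : (\bar R)^nat) (c : \bar R) :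
  (\forall n \near \oo, (u n <= c)%E) -> (limn_einf u <= c)%E.
Proof.
move=> uc; rewrite limn_einf_lim; apply: lime_le; first exact: is_cvg_einfs.
apply: filterS uc => n; apply: le_trans.
by apply: ereal_inf_lbound; exists n => /=.
Qed.

Lemma limn_einf_ge0 (R : realType) (u : (\bar R)^nat) :
  (forall n, 0 <= u n)%E -> (0 <= limn_einf u)%E.
Proof.
move=> u0; rewrite limn_einf_lim; apply: lime_ge; first exact: is_cvg_einfs.
by apply: nearW => n; apply: le_ereal_inf_tmp => _ [k _ <-].
Qed.

Lemma measurable_fun_limn_einf d (T : measurableType d) (R : realType)
    (D : set T) (f : (T -> \bar R)^nat) :
  (forall n, measurable_fun D (f n)) ->
  measurable_fun D (fun x => limn_einf (f ^~ x)).
Proof.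
move=> mf; rewrite (_ : (fun x => _) = (fun x => - limn_esup (-%E \o f ^~ x))%E).
  by apply: measurableT_comp => //; apply: measurable_fun_limn_esup => n;
    exact: measurableT_comp.
by apply/funext => x; rewrite limn_esupN oppeK.
Qed.

(** The sequence is its first term plus the telescoping series of its increments, which converges
    absolutely. *)
Lemma cvgn_of_nneseries_increments (R : realType) (v : R^nat) :
  (\sum_(0 <= k <oo) (`|v k.+1 - v k|)%:E < +oo)%E -> cvgn v.
Proof.
move=> h; suff : cvgn (series (telescope v)).
  move=> ct; rewrite (_ : v = (fun n => v 0%N + series (telescope v) n)).
    by apply: is_cvgD ct; exact: is_cvg_cst.
  by apply/funext => n; exact: eq_sum_telescope.
apply: normed_cvg; apply: nondecreasing_is_cvgn.
  move=> m n mn; rewrite /series/=.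
  exact: (@nondecreasing_series _ (fun n => `|telescope v n|) predT 0%N
    (fun n _ _ => normr_ge0 _) m n mn).
exists (fine (\sum_(0 <= k <oo) (`|v k.+1 - v k|)%:E)) => _ [n _ <-].
rewrite -lee_fin fineK; last by rewrite ge0_fin_numE// nneseries_ge0.
rewrite /series/= -sumEFin.
by apply: nneseries_lim_ge => k _ _; rewrite lee_fin.
Qed.

(** * Membership in L^2 by square integrability or boundedness *)

Section square_integrable.
Context (R : realType) d (X : measurableType d).
Variable mu : {measure set X -> \bar R}.

(** Elements of L^2 with a prescribed formula are built through this lemma. The equality is
    pointwise, so the formula can be rewritten at every point. *)
Lemma L2_of_sqr_integrable (f : X -> R) : measurable_fun setT f ->
  (\int[mu]_x ((f x) ^+ 2)%:E < +oo)%E ->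
  exists g : LfunType mu (lee1n 2), g = f :> (X -> R).
Proof.
move=> mf f2.
suff fL : f \in Lfun mu 2%:E by exists (Lfun_Sub (lee1n 2) fL).
apply/andP; split; rewrite inE//= /finite_norm.
rewrite (@lty_poweRy _ _ 2)// poweR_Lnorm// (le_lt_trans _ f2)//.
rewrite le_eqVlt; apply/orP; left; apply/eqP/eq_integral => x _ /=.
by rewrite powR_mulrn// real_normK// num_real.
Qed.

Lemma L2_bounded (f : X -> R) (c : R) : (mu setT < +oo)%E -> measurable_fun setT f ->
  {ae mu, forall x, `|f x| <= c}%R ->
  exists g : LfunType mu (lee1n 2), g = f :> (X -> R).
Proof.
move=> muoo mf fc; apply: L2_of_sqr_integrable => //.
apply: (@le_lt_trans _ _ (\int[mu]_x (cst (c ^+ 2)%:E x))%E).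
  apply: ae_ge0_le_integral => //.
  - by move=> x _; rewrite lee_fin sqr_ge0.
  - by apply/measurable_EFinP; apply: measurable_funX.
  - by move=> x _; rewrite lee_fin sqr_ge0.
  apply: filterS fc => x fc _; rewrite lee_fin.
  have c0 : 0 <= c by exact: le_trans fc.
  by rewrite -(real_normK (num_real (f x))) ler_pXn2r// nnegrE.
rewrite integral_cst// lte_mul_pinfty ?lee_fin ?sqr_ge0//.
Qed.

End square_integrable.

(** * Completeness of L^2 *)

Section L2_complete.
Context (R : realType) d (X : measurableType d).
Variable mu : {finite_measure set X -> \bar R}.

Lemma L2_cst_exists (c : R) : exists g : L2 mu, g = cst c :> (X -> R).
Proof.
apply: (@L2_bounded _ _ _ _ _ `|c|); first exact: fin_num_fun_lty.
  exact: measurable_cst.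
by apply: nearW => x /=.
Qed.

(** Riesz-Fischer argument: the increments are summable in L^1, hence pointwise almost everywhere,
    which gives a pointwise limit; Fatou's lemma transfers the norm bounds to it. *)
Lemma L2_fast_cauchy (v : nat -> L2 mu) :
  (forall k m n, (k <= m)%N -> (k <= n)%N -> nrm (v m - v n) <= 2^-1 ^+ k) ->
  exists w, forall k, nrm (v k - w) <= 2^-1 ^+ k.
Proof.
move=> vC.
have [one oneE] := L2_cst_exists 1.
pose D k x := (`|v k.+1 x - v k x|)%:E.
have mD k : measurable_fun setT (D k).
  apply/measurable_EFinP; apply: measurableT_comp => //.
  by apply: measurable_funB; exact: measurable_L2.
have D0 k x : setT x -> (0 <= D k x)%E by rewrite lee_fin.
(* On a finite measure space the L^1 norm is controlled by the L^2 norm: Cauchy-Schwarz against the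
   constant 1. *)
have absE (f : L2 mu) : (\int[mu]_x `|f x|%:E <= (nrm f * nrm one)%:E)%E.
  have [||g gE] := @L2_of_sqr_integrable _ _ _ mu (fun x => `|f x|).
  - by apply: measurableT_comp => //; exact: measurable_L2.
  - under eq_integral do rewrite (real_normK (num_real _)).
    by rewrite -sqr_nrm ltry.
  have -> : nrm f = nrm g.
    by apply/eqP; rewrite eq_le !le_nrm//; apply: nearW => x; rewrite gE normr_id.
  have := le_trans (ler_norm _) (L2_cauchy_schwarz g one).
  rewrite -lee_fin; apply: le_trans.
  rewrite /L2dot /Rintegral fineK; last first.
    by apply: integrable_fin_num => //; exact: L2dot_integrable.
  rewrite le_eqVlt; apply/orP; left; apply/eqP/eq_integral => x _.
  by rewrite gE oneE mulr1.
have sD : (\int[mu]_x (\sum_(0 <= k <oo) D k x) < +oo)%E.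
  rewrite integral_nneseries//.
  apply: (@le_lt_trans _ _ (2 * nrm one)%:E); last exact: ltry.
  apply: lime_le.
    by apply: is_cvg_nneseries => k _ _; apply: integral_ge0 => x _; exact: D0.
  apply: nearW => n.
  apply: (@le_trans _ _ (\sum_(0 <= k < n) (2^-1 ^+ k * nrm one)%:E)%E).
    apply: lee_sum => k _; apply: le_trans (absE (v k.+1 - v k)) _.
    by rewrite lee_fin ler_wpM2r ?nrm_ge0// vC.
  rewrite sumEFin lee_fin -mulr_suml ler_wpM2r ?nrm_ge0//.
  have -> : \sum_(0 <= k < n) (2^-1 : R) ^+ k = 2 - 2 * 2^-1 ^+ n.
    elim: n => [|n IH]; first by rewrite big_geq// expr0 mulr1 subrr.
    by rewrite big_nat_recr//= IH exprS; field.
  by rewrite gerBl mulr_ge0// exprn_ge0// invr_ge0.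
have cvgv : {ae mu, forall x, cvgn (fun k => v k x)}.
  have msum : measurable_fun setT (fun x => \sum_(0 <= k <oo) D k x)%E.
    by apply: ge0_emeasurable_sum => // k x _ _; exact: D0.
  have : mu.-integrable setT (fun x => \sum_(0 <= k <oo) D k x)%E.
    apply/integrableP; split => //; apply: le_lt_trans sD.
    rewrite le_eqVlt; apply/orP; left; apply/eqP/eq_integral => x _.
    by rewrite gee0_abs// nneseries_ge0// => k _ _; exact: D0.
  move=> /(integrable_ae measurableT); apply: filterS => x /(_ Logic.I) fx.
  by apply: cvgn_of_nneseries_increments; rewrite ltey_eq fx.
(* The upper limit is measurable and defined everywhere; it is the limit wherever the sequence
   converges. *)
pose w0 x := fine (limn_esup (fun k => (v k x)%:E)).
have mw0 : measurable_fun setT w0.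
  apply: measurableT_comp => //; apply: measurable_fun_limn_esup => k.
  by apply/measurable_EFinP; exact: measurable_L2.
have vw0 : {ae mu, forall x, v k x @[k --> \oo] --> w0 x}.
  apply: filterS cvgv => x cv.
  have : (v k x)%:E @[k --> \oo] --> (limn (v ^~ x))%:E.
    by apply: cvg_EFin => //; exact: nearW.
  by move=> /cvg_limn_einf_sup[_ h]; rewrite /w0 h.
have bd k : (\int[mu]_x ((v k x - w0 x) ^+ 2)%:E <= ((2^-1 ^+ k) ^+ 2)%:E)%E.
  pose f j x := ((v k x - v j x) ^+ 2)%:E.
  have mf j : measurable_fun setT (f j).
    apply/measurable_EFinP; apply: measurable_funX.
    by apply: measurable_funB; exact: measurable_L2.
  have f0 j x : setT x -> (0 <= f j x)%E by rewrite lee_fin sqr_ge0.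
  apply: (@le_trans _ _ (\int[mu]_x limn_einf (f^~ x))%E).
    apply: ae_ge0_le_integral => //.
    - by move=> x _; rewrite lee_fin sqr_ge0.
    - apply/measurable_EFinP; apply: measurable_funX.
      by apply: measurable_funB => //; exact: measurable_L2.
    - by move=> x _; apply: limn_einf_ge0 => j; exact: f0.
    - exact: measurable_fun_limn_einf.
    apply: filterS vw0 => x vx _.
    suff /cvg_limn_einf_sup[-> _] : f^~ x @ \oo --> ((v k x - w0 x) ^+ 2)%:E by [].
    apply: cvg_EFin; first exact: nearW.
    by apply: cvgM; apply: cvgB => //; exact: cvg_cst.
  apply: le_trans (fatou _ _ _ _) _ => //.
  apply: limn_einf_le; exists k => // j /= kj.
  have -> : (\int[mu]_x f j x)%E = ((nrm (v k - v j)) ^+ 2)%:E by rewrite sqr_nrm.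
  rewrite lee_fin ler_pXn2r// ?nnegrE ?nrm_ge0// ?exprn_ge0 ?invr_ge0//.
  exact: vC.
(* Square integrability is known for [v 0 - w0], by [bd 0]. The limit is therefore taken as
   [v 0 - h], which equals [w0] pointwise. *)
have [||h hE] := @L2_of_sqr_integrable _ _ _ mu (fun x => v 0 x - w0 x).
- by apply: measurable_funB => //; exact: measurable_L2.
- by apply: le_lt_trans (bd 0%N) _; exact: ltry.
exists (v 0 - h) => k.
have := bd k.
rewrite -(@ler_pXn2r _ 2)// ?nnegrE ?nrm_ge0// ?exprn_ge0 ?invr_ge0// -lee_fin sqr_nrm.
apply: le_trans; rewrite le_eqVlt; apply/orP; left; apply/eqP/eq_integral => x _.
by rewrite !(L2addE, L2oppE) hE; congr EFin; ring.
Qed.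

Lemma L2_complete (u : nat -> L2 mu) :
  (forall e, 0 < e -> \forall n \near \oo,
    forall m, (n <= m)%N -> nrm (u m - u n) <= e) ->
  exists w, nrm (u n - w) @[n --> \oo] --> 0.
Proof.
move=> uC.
have /choice[N NP] k : exists N, forall m n, (N <= m)%N -> (N <= n)%N ->
    nrm (u m - u n) <= 2^-1 ^+ k.
  have [|N _ /= NP] := uC (2^-1 ^+ k.+1); first by rewrite exprn_gt0// invr_gt0.
  exists N => m n Nm Nn.
  rewrite (le_trans (nrm_triangle (u N) _ _))//.
  rewrite [nrm (u N - _)]nrmB [leRHS](_ : _ = 2^-1 ^+ k.+1 + 2^-1 ^+ k.+1).
    by apply: lerD; apply: NP => /=.
  by rewrite exprS; field.
(* The ranks [N j] need not increase with [j]. Their partial sums dominate all the earlier ranks, so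
   [u \o p] is a fast Cauchy subsequence. *)
pose p k := (\sum_(j < k.+1) N j)%N.
have Np k j : (k <= j)%N -> (N k <= p j)%N.
  move=> kj; rewrite /p (bigD1 (inord k))//= inordK ?ltnS//.
  exact: leq_addr.
have [|w wP] := @L2_fast_cauchy (u \o p).
  by move=> k m n km kn; apply: NP; exact: Np.
exists w; apply/cvgrPdist_le => e e0.
have [k ke] : exists k, (2^-1 : R) ^+ k <= e / 2.
  have e2 : 0 < e / 2 by exact: divr_gt0.
  have [k _ /(_ k (leqnn _))] := near_infty_natSinv_expn_lt (PosNum e2).
  by rewrite /= div1r -exprVn => /ltW; exists k.
exists (N k) => // n /= Nn.
rewrite sub0r normrN ger0_norm ?nrm_ge0//.
rewrite (le_trans (nrm_triangle (u (p k)) _ _))// [leRHS]splitr.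
apply: lerD; last exact: le_trans (wP k) _.
by apply: le_trans ke; apply: NP => //; exact: Np.
Qed.

End L2_complete.

(** * Bochner integrals *)

(* The integral of a non-measurable nonnegative function is a supremum over the
   simple functions below it: it is monotone but not additive. *)
Section lower_integral.
Import HBNNSimple.
Context d (T : measurableType d) (R : realType).
Variable nu : {measure set T -> \bar R}.
Local Open Scope ereal_scope.

(** Here [f1] may be non-measurable. Each simple function below [f1] is compared with [f2]
    separately. *)
Lemma ae_lower_integral_le (f1 f2 : T -> \bar R) :
  (forall x, 0 <= f1 x) -> (forall x, 0 <= f2 x) -> measurable_fun setT f2 ->
  {ae nu, forall x, f1 x <= f2 x} -> \int[nu]_x f1 x <= \int[nu]_x f2 x.
Proof.
move=> f10 f20 mf2 f12; rewrite (ge0_integralTE _ f10).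
apply: ge_ereal_sup => _ [h /= hf <-].
rewrite -integralT_nnsfun; apply: ae_ge0_le_integral => //.
- by move=> x _; rewrite lee_fin.
- by apply/measurable_EFinP.
- by apply: filterS f12 => x f12 _; exact: le_trans (hf x) f12.
Qed.

(** Here [f2] may be non-measurable. Setting [f1] to 0 on a null set makes the inequality hold
    everywhere without changing the integral of [f1]. *)
Lemma ae_integral_le_lower (f1 f2 : T -> \bar R) :
  (forall x, 0 <= f1 x) -> (forall x, 0 <= f2 x) -> measurable_fun setT f1 ->
  {ae nu, forall x, f1 x <= f2 x} -> \int[nu]_x f1 x <= \int[nu]_x f2 x.
Proof.
move=> f10 f20 mf1 [N [mN N0 f12]].
have mCN : measurable (~` N) by exact: measurableC.
have -> : \int[nu]_x f1 x = \int[nu]_x (f1 \_ (~` N)) x.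
  rewrite -integral_mkcond -(setTD N).
  by apply: ge0_negligible_integral.
have f1N x : 0 <= (f1 \_ (~` N)) x by rewrite /patch; case: ifP.
rewrite (ge0_integralTE _ f1N) (ge0_integralTE _ f20).
apply: le_ereal_sup => _ [h /= hf <-]; exists h => // x.
apply: le_trans (hf x) _; rewrite /patch; case: ifPn => // xN.
by apply: contrapT => nf; move: xN; rewrite inE/= => /(_ (f12 x nf)).
Qed.

Lemma integrable_indic_fin (A : set T) : measurable A -> nu A < +oo ->
  nu.-integrable setT (EFin \o (\1_A : T -> R)).
Proof.
move=> mA Afin; apply/integrableP; split.
  by apply/measurable_EFinP; exact: measurable_indic.
under eq_integral do rewrite gee0_abs ?lee_fin//.
by rewrite integral_indic// setIT.
Qed.

End lower_integral.

(** * Simple functions with values in L^2 *)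

Section simple.
Context (R : realType) d (X : measurableType d).
Variable mu : {finite_measure set X -> \bar R}.
Context d' (Y : measurableType d').
Variable nu : {measure set Y -> \bar R}.
Implicit Types s : seq (set Y * L2 mu).

Definition simple_ok s :=
  forall p, p \in s -> measurable p.1 /\ (nu p.1 < +oo)%E.

Definition simple_scale (a : R) s := [seq (p.1, a *: p.2) | p <- s].

Definition simple_restrict (E : set Y) s := [seq (p.1 `&` E, p.2) | p <- s].

Definition simple_comp d1 (Y1 : measurableType d1) (phi : Y1 -> Y) s
    : seq (set Y1 * L2 mu) := [seq (phi @^-1` p.1, p.2) | p <- s].

Lemma L2simple_cat s1 s2 t :
  L2simple (s1 ++ s2) t = L2simple s1 t + L2simple s2 t.
Proof. by rewrite /L2simple big_cat. Qed.

Lemma L2simple_scale a s t : L2simple (simple_scale a s) t = a *: L2simple s t.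
Proof.
rewrite /L2simple big_map scaler_sumr; apply: eq_bigr => p _ /=.
by rewrite !scalerA mulrC.
Qed.

Lemma L2simple_restrict E s t :
  L2simple (simple_restrict E s) t = (\1_E t : R) *: L2simple s t.
Proof.
rewrite /L2simple big_map scaler_sumr; apply: eq_bigr => p _ /=.
by rewrite indicI scalerA /= mulrC.
Qed.

Lemma L2simple_comp d1 (Y1 : measurableType d1) (phi : Y1 -> Y) s t :
  L2simple (simple_comp phi s) t = L2simple s (phi t).
Proof. by rewrite /L2simple big_map. Qed.

Lemma L2simple_integral_cat s1 s2 :
  L2simple_integral nu (s1 ++ s2) =
  L2simple_integral nu s1 + L2simple_integral nu s2.
Proof. by rewrite /L2simple_integral big_cat. Qed.

Lemma L2simple_integral_scale a s :
  L2simple_integral nu (simple_scale a s) = a *: L2simple_integral nu s.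
Proof.
rewrite /L2simple_integral big_map scaler_sumr; apply: eq_bigr => p _ /=.
by rewrite !scalerA mulrC.
Qed.

Lemma simple_ok_cat s1 s2 : simple_ok s1 -> simple_ok s2 -> simple_ok (s1 ++ s2).
Proof. by move=> h1 h2 p; rewrite mem_cat => /orP[/h1|/h2]. Qed.

Lemma simple_ok_scale a s : simple_ok s -> simple_ok (simple_scale a s).
Proof. by move=> sok _ /mapP[p /sok ps ->]. Qed.

Lemma simple_ok_restrict E s : measurable E -> simple_ok s ->
  simple_ok (simple_restrict E s).
Proof.
move=> mE sok _ /mapP[p /sok[mp pfin] ->] /=; split; first exact: measurableI.
by apply: le_lt_trans pfin; apply: le_measure; rewrite ?inE//; exact: measurableI.
Qed.

(** A simple function takes finitely many values, each on a measurable set, so [phi] can be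
    arbitrary. The induction generalizes [phi] in order to absorb the first term of the list as a
    translation. *)
Lemma measurable_L2simple s (phi : L2 mu -> R) : simple_ok s ->
  measurable_fun setT (fun t => phi (L2simple s t)).
Proof.
elim: s phi => [|p s IH] phi sok.
  rewrite (_ : (fun t => _) = cst (phi 0)); first exact: measurable_cst.
  by apply/funext => t; rewrite /L2simple big_nil.
have sok' : simple_ok s by move=> q qs; apply: sok; rewrite inE qs orbT.
have [mp _] := sok p (mem_head _ _).
rewrite (_ : (fun t => _) = (fun t => if t \in p.1
    then phi (1 *: p.2 + L2simple s t) else phi (0 *: p.2 + L2simple s t))).
  apply: measurable_fun_if => //.
  - apply: (measurable_fun_bool true) => //.
    rewrite setTI (_ : _ @^-1` _ = p.1)//; apply/seteqP; split => x /=; rewrite ?inE//.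
    by move=> /set_mem.
    by move=> /mem_set.
  - apply: measurable_funS (IH (fun f => phi (1 *: p.2 + f)) sok') => //.
  - apply: measurable_funS (IH (fun f => phi (0 *: p.2 + f)) sok') => //.
apply/funext => t; rewrite /L2simple big_cons indicE.
by case: (t \in p.1).
Qed.

Lemma L2simple_dot_integral s y : simple_ok s ->
  nu.-integrable setT (EFin \o (fun t => L2dot (L2simple s t) y)) /\
  \int[nu]_t L2dot (L2simple s t) y = L2dot (L2simple_integral nu s) y.
Proof.
elim: s => [|p s IH] sok.
  rewrite /L2simple_integral /L2simple; split.
    apply: (eq_integrable _ (cst 0%E)) => //; last exact: integrable0.
    by move=> t _ /=; rewrite big_nil L2dot0l.
  under eq_Rintegral do rewrite big_nil L2dot0l.
  by rewrite Rintegral_cst// mul0r big_nil L2dot0l.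
have sok' : simple_ok s by move=> q qs; apply: sok; rewrite inE qs orbT.
have [mp pfin] := sok p (mem_head _ _).
have [i1 e1] := IH sok'.
have i2 : nu.-integrable setT (EFin \o (fun t => (\1_(p.1) t * L2dot p.2 y))).
  have i0 := integrable_indic_fin mp pfin.
  by apply: eq_integrable (integrableZr _ (L2dot p.2 y) i0) => // t _ /=.
have E t : L2dot (L2simple (p :: s) t) y =
    \1_(p.1) t * L2dot p.2 y + L2dot (L2simple s t) y.
  by rewrite /L2simple big_cons L2dotDl L2dotZl.
split.
  apply: eq_integrable (integrableD _ i2 i1) => // t _ /=.
  by rewrite E EFinD.
under eq_Rintegral do rewrite E.
rewrite RintegralD// e1 /L2simple_integral big_cons L2dotDl L2dotZl; congr (_ + _).
rewrite RintegralZr//; last exact: integrable_indic_fin pfin.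
by rewrite /Rintegral integral_indic// setIT.
Qed.

(* By duality: pair the integral with itself. *)
Lemma nrm_L2simple_integral s : simple_ok s ->
  ((nrm (L2simple_integral nu s))%:E <= \int[nu]_t (nrm (L2simple s t))%:E)%E.
Proof.
move=> sok; set y := L2simple_integral nu s.
have [y0|y0] := eqVneq (nrm y) 0.
  by rewrite y0 integral_ge0// => t _; rewrite lee_fin nrm_ge0.
have {}y0 : 0 < nrm y by rewrite lt_neqAle eq_sym y0 nrm_ge0.
have [i1 e1] := L2simple_dot_integral y sok.
have mn : measurable_fun setT (fun t => (nrm (L2simple s t))%:E).
  by apply/measurable_EFinP; exact: (@measurable_L2simple s (@nrm _ _ _ _)).
(* After multiplication by [nrm y], the left side is [L2dot y y], the integral of
   [L2dot (L2simple s t) y]. Cauchy-Schwarz bounds this integrand. *)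
rewrite -(@lee_pmul2l _ (nrm y)%:E)// -EFinM -expr2 -L2dotff -e1.
rewrite -ge0_integralZl ?lee_fin ?nrm_ge0//; last first.
  by move=> t _; rewrite lee_fin nrm_ge0.
rewrite /Rintegral fineK; last exact: integrable_fin_num.
apply: (le_trans (lee_abs _)); apply: (le_trans (le_abse_integral _ _ _)) => //.
  exact: measurable_int i1.
apply: ge0_le_integral => //.
- by apply: measurableT_comp => //; exact: measurable_int i1.
- exact: measurable_funeM.
- by move=> t _; rewrite lee_fin mulrC; exact: L2_cauchy_schwarz.
Qed.

End simple.

(** * Existence, uniqueness, linearity and bounds for Bochner integrals *)

Section bochner_theory.
Context (R : realType) d (X : measurableType d).
Variable mu : {finite_measure set X -> \bar R}.
Context d' (Y : measurableType d').
Variable nu : {measure set Y -> \bar R}.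
Implicit Types (g : Y -> L2 mu) (s : nat -> seq (set Y * L2 mu)).
Implicit Types (h : nat -> Y -> \bar R) (w : L2 mu).

(* In [is_bochner] the error [t |-> L2norm (g t - L2simple (s n) t)] need not be
   measurable, so its integral cannot be added to others.  It is a.e. equal to
   the measurable function [simple_dist s n], and all estimates go through the
   measurable majorants [h n]. *)
Definition bochner_majorized g s h : Prop :=
  [/\ forall n, simple_ok nu (s n),
      forall n, measurable_fun setT (h n),
      forall n t, (0 <= h n t)%E,
      {ae nu, forall t,
        (forall n, ((nrm (g t - L2simple (s n) t))%:E <= h n t)%E) /\
        nrm (g t - L2simple (s n) t) @[n --> \oo] --> 0}
    & (\int[nu]_t h n t)%E @[n --> \oo] --> 0%E ].

(** The value [g t] is replaced by the limit of the simple functions themselves, so measurability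
    does not involve [g]. The upper limit makes sense at every [t]. *)
Definition simple_dist s n t : \bar R :=
  limn_esup (fun m => (nrm (L2simple (s m) t - L2simple (s n) t))%:E).

Lemma nrm_cvg_sub (a : nat -> L2 mu) (b c : L2 mu) :
  nrm (b - a n) @[n --> \oo] --> 0 -> nrm (a n - c) @[n --> \oo] --> nrm (b - c).
Proof.
move=> ab; apply/cvgrPdist_le => e e0.
have /cvgrPdist_le/(_ _ e0) := ab; apply: filterS => n.
rewrite sub0r normrN ger0_norm ?nrm_ge0// => h.
rewrite ler_norml; apply/andP; split.
  by rewrite lerNl opprB lerBlDl (le_trans (nrm_triangle b _ _))// addrC lerD2l nrmB.
by rewrite lerBlDl (le_trans (nrm_triangle (a n) _ _))// addrC lerD2l.
Qed.

Lemma measurable_simple_distm s n m : (forall n, simple_ok nu (s n)) ->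
  measurable_fun setT (fun t => (nrm (L2simple (s m) t - L2simple (s n) t))%:E).
Proof.
move=> sok; apply/measurable_EFinP.
have ok : simple_ok nu (s m ++ simple_scale (-1) (s n)).
  by apply: simple_ok_cat => //; exact: simple_ok_scale.
have := measurable_L2simple (@nrm _ _ _ mu) ok.
by under eq_fun do rewrite L2simple_cat L2simple_scale scaleN1r.
Qed.

Lemma measurable_simple_dist s n : (forall n, simple_ok nu (s n)) ->
  measurable_fun setT (simple_dist s n).
Proof.
move=> sok; apply: measurable_fun_limn_esup => m.
exact: measurable_simple_distm.
Qed.

Lemma simple_dist_ge0 s n t : (0 <= simple_dist s n t)%E.
Proof.
apply: le_trans (limn_einf_sup _); apply: limn_einf_ge0 => m.
by rewrite lee_fin nrm_ge0.
Qed.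

Lemma simple_distE g s n t :
  nrm (g t - L2simple (s n) t) @[n --> \oo] --> 0 ->
  simple_dist s n t = (nrm (g t - L2simple (s n) t))%:E.
Proof.
move=> /nrm_cvg_sub => /(_ (L2simple (s n) t)) h.
have : (nrm (L2simple (s m) t - L2simple (s n) t))%:E @[m --> \oo] -->
    (nrm (g t - L2simple (s n) t))%:E.
  by apply: cvg_EFin => //; exact: nearW.
by move=> /cvg_limn_einf_sup[].
Qed.

(** The majorant is [simple_dist s]. Being measurable and a.e. equal to the error, its integral is
    at most the lower integral of the error, which tends to 0. *)
Lemma is_bochner_majorized g w : is_bochner nu g w ->
  exists s h, bochner_majorized g s h /\
    nrm (L2simple_integral nu (s n) - w) @[n --> \oo] --> 0.
Proof.
move=> [s [sok sg sint sw]]; exists s, (simple_dist s).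
have sok' n : simple_ok nu (s n) by move=> p; exact: sok.
have {}sg : {ae nu, forall t, nrm (g t - L2simple (s n) t) @[n --> \oo] --> 0}.
  by apply: filterS sg => t /L2norm_cvg0.
split; last exact/L2norm_cvg0.
split => //.
- by move=> n; exact: measurable_simple_dist.
- exact: simple_dist_ge0.
- apply: filterS sg => t st; split => // n.
  by rewrite (simple_distE _ st).
- apply: squeeze_cvge (cvg_cst 0%E) sint.
  apply: nearW => n; rewrite integral_ge0/=; last by move=> t _; exact: simple_dist_ge0.
  apply: ae_integral_le_lower; first exact: simple_dist_ge0.
  + by move=> t; rewrite L2normE lee_fin nrm_ge0.
  + exact: measurable_simple_dist.
  + by apply: filterS sg => t st; rewrite (simple_distE _ st) L2normE.
Qed.

(** Conversely, a measurable majorant bounds the lower integral of the error from above. *)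
Lemma majorized_is_bochner g s h w : bochner_majorized g s h ->
  nrm (L2simple_integral nu (s n) - w) @[n --> \oo] --> 0 -> is_bochner nu g w.
Proof.
move=> [sok mh h0 hg hint] sw; exists s; split.
- exact: sok.
- by apply: filterS hg => t [_ hg]; exact/L2norm_cvg0.
- apply: squeeze_cvge (cvg_cst 0%E) hint; apply: nearW => n.
  have n0 t : (0 <= L2norm (g t - L2simple (s n) t)%R)%E.
    by rewrite L2normE lee_fin nrm_ge0.
  rewrite integral_ge0//=.
  by apply: ae_lower_integral_le => //; apply: filterS hg => t [hg _]; rewrite L2normE.
- exact/L2norm_cvg0.
Qed.

(** Triangle inequality through [g t] under the integral. It makes the integrals of the approximants
    a Cauchy sequence. *)
Lemma majorized_integral_dist g s h n m : bochner_majorized g s h ->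
  ((nrm (L2simple_integral nu (s m) - L2simple_integral nu (s n)))%:E <=
   \int[nu]_t h m t + \int[nu]_t h n t)%E.
Proof.
move=> [sok mh h0 hg _].
have ok : simple_ok nu (s m ++ simple_scale (-1) (s n)).
  by apply: simple_ok_cat => //; exact: simple_ok_scale.
have := nrm_L2simple_integral ok.
rewrite L2simple_integral_cat L2simple_integral_scale scaleN1r => /le_trans; apply.
rewrite -ge0_integralD//.
under eq_integral do rewrite L2simple_cat L2simple_scale scaleN1r.
apply: ae_ge0_le_integral => //.
- by move=> t _; rewrite lee_fin nrm_ge0.
- exact: measurable_simple_distm.
- by move=> t _; rewrite adde_ge0.
- exact: emeasurable_funD.
- apply: filterS hg => t [hg _] _.
  apply: le_trans (leeD (hg m) (hg n)); rewrite -EFinD lee_fin.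
  by rewrite [nrm (g t - L2simple (s m) t)]nrmB; exact: nrm_triangle.
Qed.

Lemma majorized_bochner_exists g s h : bochner_majorized g s h ->
  exists w, nrm (L2simple_integral nu (s n) - w) @[n --> \oo] --> 0.
Proof.
move=> gsh; apply: L2_complete => e e0.
have [sok mh h0 hg hint] := gsh.
have [N _ NP] : \forall n \near \oo, (\int[nu]_t h n t <= (e / 2)%:E)%E.
  have e2 : 0 < e / 2 by exact: divr_gt0.
  have /fine_cvgP[fin /cvgrPdist_le/(_ _ e2)] := hint.
  apply: filterS2 fin => n fin /=; rewrite sub0r normrN => ne.
  by rewrite -[leLHS]fineK// lee_fin (le_trans (ler_norm _)).
exists N => // n /= Nn m nm.
rewrite -lee_fin (le_trans (majorized_integral_dist _ _ gsh))//.
by rewrite [e]splitr EFinD leeD//; apply: NP => //=; exact: leq_trans nm.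
Qed.

(** The bound holds for the approximants up to the integral of [h n], and passes to the limit. The
    measurable majorant [k] stands in for the norm of [g], which may fail to be measurable. *)
Lemma bochner_bound g w (k : Y -> \bar R) : is_bochner nu g w ->
  measurable_fun setT k -> (forall t, 0 <= k t)%E ->
  {ae nu, forall t, (nrm (g t))%:E <= k t}%E -> ((nrm w)%:E <= \int[nu]_t k t)%E.
Proof.
move=> /is_bochner_majorized[s [h [[sok mh h0 hg hint] sw]]] mk k0 gk.
have bd n : ((nrm (L2simple_integral nu (s n)))%:E <=
    \int[nu]_t k t + \int[nu]_t h n t)%E.
  apply: le_trans (nrm_L2simple_integral (sok n)) _.
  rewrite -ge0_integralD//; apply: ae_ge0_le_integral => //.
  - by move=> t _; rewrite lee_fin nrm_ge0.
  - by apply/measurable_EFinP; exact: (measurable_L2simple (@nrm _ _ _ mu)).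
  - by move=> t _; rewrite adde_ge0.
  - exact: emeasurable_funD.
  - apply: filterS2 hg gk => t [hg _] gk _.
    apply: le_trans (leeD gk (hg n)); rewrite -EFinD lee_fin nrmB.
    exact: nrm_le_sub.
(* An infinite right-hand side is set apart, so that the limit of the sum below is defined. *)
have [->|kfin] := eqVneq (\int[nu]_t k t)%E +oo%E; first exact: leey.
have {}kfin : (\int[nu]_t k t \is a fin_num)%E.
  by rewrite ge0_fin_numE ?lt_neqAle ?kfin ?leey//; apply: integral_ge0.
have c1 : (nrm (L2simple_integral nu (s n)))%:E @[n --> \oo] --> (nrm w)%:E.
  apply: cvg_EFin; first exact: nearW.
  have : nrm (w - L2simple_integral nu (s n)) @[n --> \oo] --> 0.
    by under eq_fun do rewrite nrmB.
  move=> /nrm_cvg_sub h'; have := h' 0.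
  by rewrite subr0; under eq_fun do rewrite subr0.
have c2 : (\int[nu]_t k t + \int[nu]_t h n t)%E @[n --> \oo] --> (\int[nu]_t k t + 0)%E.
  apply: cvgeD => //; last exact: cvg_cst.
  exact: fin_num_adde_defr.
rewrite -[leRHS]adde0 -(cvg_lim _ c1)// -(cvg_lim _ c2)//.
apply: lee_lim; [exact: cvgP c1|exact: cvgP c2|exact: nearW].
Qed.

Lemma is_bochner_congr g g' w : {ae nu, forall t, L2eq (g t) (g' t)} ->
  is_bochner nu g w -> is_bochner nu g' w.
Proof.
move=> gg /is_bochner_majorized[s [h [[sok mh h0 hg hint] sw]]].
apply: (@majorized_is_bochner _ s h) => //; split => //.
have E t n : L2eq (g t) (g' t) ->
    nrm (g t - L2simple (s n) t) = nrm (g' t - L2simple (s n) t).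
  by move=> ggt; apply: nrm_eq; apply: L2eqD => //; exact: L2eq_refl.
apply: filterS2 hg gg => t [hg hg'] ggt; split; first by move=> n; rewrite -E.
by under eq_fun do rewrite -(E _ _ ggt).
Qed.

Lemma is_bochner_lin g g' w w' (a b : R) :
  is_bochner nu g w -> is_bochner nu g' w' ->
  is_bochner nu (fun t => a *: g t + b *: g' t) (a *: w + b *: w').
Proof.
move=> /is_bochner_majorized[s [h [[sok mh h0 hg hint] sw]]].
move=> /is_bochner_majorized[s' [h' [[sok' mh' h0' hg' hint'] sw']]].
pose S n := simple_scale a (s n) ++ simple_scale b (s' n).
pose H n t := (`|a|%:E * h n t + `|b|%:E * h' n t)%E.
have split4 (x y x' y' : L2 mu) :
    nrm (a *: x + b *: y - (a *: x' + b *: y')) <=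
    `|a| * nrm (x - x') + `|b| * nrm (y - y').
  rewrite -!nrmZ !scalerBr opprD addrACA; exact: nrmD.
have c0 (u v : nat -> R) : u n @[n --> \oo] --> 0 -> v n @[n --> \oo] --> 0 ->
    `|a| * u n + `|b| * v n @[n --> \oo] --> 0.
  move=> u0 v0; rewrite -[X in _ --> X](_ : `|a| * 0 + `|b| * 0 = 0).
    by apply: cvgD; apply: cvgM => //; exact: cvg_cst.
  by rewrite !mulr0 addr0.
apply: (@majorized_is_bochner _ S H).
  split.
  - by move=> n; apply: simple_ok_cat; exact: simple_ok_scale.
  - by move=> n; apply: emeasurable_funD; exact: measurable_funeM.
  - by move=> n t; rewrite /H adde_ge0// mule_ge0.
  - apply: filterS2 hg hg' => t [hg hg0] [hg' hg0']; split.
      move=> n; rewrite L2simple_cat !L2simple_scale.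
      apply: (@le_trans _ _ (`|a| * nrm (g t - L2simple (s n) t) +
        `|b| * nrm (g' t - L2simple (s' n) t))%:E); first by rewrite lee_fin split4.
      by rewrite /H EFinD !EFinM leeD// lee_wpmul2l.
    apply: (squeeze_cvgr _ (cvg_cst 0) (c0 _ _ hg0 hg0')).
    by apply: nearW => n; rewrite nrm_ge0/= L2simple_cat !L2simple_scale split4.
  - rewrite /H; have -> : (fun n => \int[nu]_t (`|a|%:E * h n t + `|b|%:E * h' n t))%E =
      (fun n => `|a|%:E * \int[nu]_t h n t + `|b|%:E * \int[nu]_t h' n t)%E.
      apply/funext => n; rewrite ge0_integralD//; last 4 first.
      + by move=> t _; rewrite mule_ge0.
      + exact: measurable_funeM.
      + by move=> t _; rewrite mule_ge0.
      + exact: measurable_funeM.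
      by rewrite !ge0_integralZl//.
    rewrite -[X in _ --> X](_ : `|a|%:E * 0 + `|b|%:E * 0 = 0)%E; last first.
      by rewrite !mule0 adde0.
    apply: cvgeD; first by rewrite !mule0.
      by apply: cvgeZl.
    by apply: cvgeZl.
apply: (squeeze_cvgr _ (cvg_cst 0) (c0 _ _ sw sw')).
apply: nearW => n; rewrite nrm_ge0/= /S L2simple_integral_cat.
by rewrite !L2simple_integral_scale split4.
Qed.

(** The difference of the integrals is an integral of a function that vanishes almost everywhere, so
    [bochner_bound] applies with majorant 0. *)
Lemma is_bochner_unique g g' w w' : {ae nu, forall t, L2eq (g t) (g' t)} ->
  is_bochner nu g w -> is_bochner nu g' w' -> L2eq w w'.
Proof.
move=> gg bg bg'; apply: nrm_sub_eq0.
have := is_bochner_lin 1 (-1) bg bg'; rewrite scale1r scaleN1r => b.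
apply/eqP; rewrite eq_le nrm_ge0 andbT -lee_fin.
have := @bochner_bound _ _ (cst 0%E) b.
rewrite integral0; apply => //.
apply: filterS gg => t ggt; rewrite lee_fin scale1r scaleN1r -(nrm0 mu).
rewrite le_eqVlt; apply/orP; left; apply/eqP/nrm_eq.
by apply: filterS ggt => x + xT => /(_ xT) h; rewrite L2addE L2oppE h subrr.
Qed.

(** Dominated convergence, the constant [D] being integrable on a space of finite measure. *)
Lemma bounded_is_bochner g s (D : R) : (nu setT < +oo)%E ->
  (forall n, simple_ok nu (s n)) ->
  {ae nu, forall t, (forall n, nrm (g t - L2simple (s n) t) <= D) /\
     nrm (g t - L2simple (s n) t) @[n --> \oo] --> 0} ->
  exists w, is_bochner nu g w.
Proof.
move=> nufin sok sg.
suff gsh : bochner_majorized g s (simple_dist s).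
  have [w sw] := majorized_bochner_exists gsh.
  by exists w; exact: majorized_is_bochner gsh sw.
have ms n := measurable_simple_dist n sok.
split => //; first exact: simple_dist_ge0.
  by apply: filterS sg => t [sD st]; split => // n; rewrite (simple_distE _ st).
have [|||_ _] := @dominated_convergence _ _ _ nu setT measurableT
  (simple_dist s) (cst 0%E) (cst D%:E) ms (measurable_cst _).
- apply: filterS sg => t [_ st] _.
  under eq_fun do rewrite (simple_distE _ st).
  by apply: cvg_EFin => //; exact: nearW.
- apply/integrableP; split => //=.
  by rewrite integral_cst//= lte_mul_pinfty.
- apply: filterS sg => t [sD st] n _.
  by rewrite (simple_distE _ st) gee0_abs ?lee_fin ?nrm_ge0.
- by rewrite integral0.
Qed.

End bochner_theory.

(** Restriction to [E] and change of variables at once. The approximants restricted to [E] and those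
    composed with [phi] have equal integrals, hence a common limit. It is applied to a translation
    in time. *)
Lemma is_bochner_restrict_comp (R : realType) d (X : measurableType d)
    (mu : {finite_measure set X -> \bar R}) d' (Y : measurableType d')
    (nu : {measure set Y -> \bar R}) (g : Y -> L2 mu) (w : L2 mu)
    (E : set Y) d1 (Y1 : measurableType d1)
    (nu1 : {measure set Y1 -> \bar R}) (phi : Y1 -> Y)
    (mphi : measurable_fun setT phi) : measurable E ->
  (forall A, measurable A -> nu1 (phi @^-1` A) = nu (A `&` E)) ->
  is_bochner nu g w ->
  exists w', is_bochner nu (fun t => (\1_E t : R) *: g t) w' /\
    is_bochner nu1 (g \o phi) w'.
Proof.
move=> mE nu1E /is_bochner_majorized[s [h [gsh _]]].
have [sok mh h0 hg hint] := gsh.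
have rok n := simple_ok_restrict mE (sok n).
have gsh' : bochner_majorized nu (fun t => (\1_E t : R) *: g t)
    (simple_restrict E \o s) h.
  split => //; apply: filterS hg => t [hg hg0].
  have le1 n : nrm ((\1_E t : R) *: g t - L2simple ((simple_restrict E \o s) n) t) <=
      nrm (g t - L2simple (s n) t).
    rewrite L2simple_restrict -scalerBr nrmZ ler_piMl ?nrm_ge0//.
    by rewrite indicE; case: (_ \in _); rewrite ?normr1 ?normr0.
  split; first by move=> n; apply: le_trans (hg n); rewrite lee_fin.
  apply: (squeeze_cvgr _ (cvg_cst 0) hg0).
  by apply: nearW => n; rewrite nrm_ge0 le1.
have [w' sw'] := majorized_bochner_exists gsh'.
exists w'; split; first exact: majorized_is_bochner gsh' sw'.
apply: (@majorized_is_bochner _ _ _ _ _ _ nu1 _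
    (fun n => simple_comp phi (s n)) (fun n => h n \o phi)).
  split.
  - move=> n _ /mapP[p /sok[mp pfin] ->] /=; split.
      by rewrite -[X in measurable X]setTI; exact: mphi.
    rewrite nu1E//; apply: le_lt_trans pfin.
    by apply: le_measure; rewrite ?inE//; exact: measurableI.
  - by move=> n; exact: measurableT_comp.
  - by move=> n t; exact: h0.
  - have [N [mN N0 hN]] := hg; exists (phi @^-1` N); split.
    + by rewrite -[X in measurable X]setTI; exact: mphi.
    + rewrite nu1E//; apply/eqP; rewrite -measure_le0 -N0.
      by apply: le_measure; rewrite ?inE//; exact: measurableI.
    + move=> t /= nt; apply: hN => /= -[hg1 hg2]; apply: nt; split.
        by move=> n; rewrite L2simple_comp.
      by under eq_fun do rewrite L2simple_comp.
  - apply: squeeze_cvge (cvg_cst 0%E) hint; apply: nearW => n /=.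
    rewrite integral_ge0/=; last by move=> t _; exact: h0.
    have -> : (\int[nu1]_t h n (phi t) = \int[pushforward nu1 phi]_t h n t)%E.
      by rewrite ge0_integral_pushforward// preimage_setT.
    (* The image of [nu1] under [phi] is [nu] restricted to [E], hence at most [nu]. *)
    apply: (@ge0_le_measure_integral _ _ _
      (@measure_function_pushforward__canonical__measure_function_Measure
        _ _ _ _ _ nu1 _ mphi) nu) => // A mA.
    rewrite /= /pushforward nu1E//.
    by apply: le_measure; rewrite ?inE//; exact: measurableI.
rewrite (_ : (fun n => _) = (fun n =>
  nrm (L2simple_integral nu ((simple_restrict E \o s) n) - w')))//.
apply/funext => n; congr (nrm (_ - _)).
rewrite /L2simple_integral !big_map; apply: eq_big_seq => p /sok[mp _] /=.
by rewrite nu1E.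
Qed.

(** * Controls and their cost *)

Section time_measure.
Context (R : realType).
Implicit Types (T h : R) (A : set (measurableTypeR R)).

Lemma time_measureE T A :
  time_measure T A = lebesgue_measure (A `&` [set` `]0, T[]).
Proof. by []. Qed.

Lemma time_measureT T : 0 <= T -> time_measure T setT = T%:E.
Proof.
move=> T0; rewrite time_measureE setTI.
have := lebesgue_measure_itv `]0, T[; rewrite /= lte_fin => ->.
by case: ltgtP T0 => // [_ _|<- _]; rewrite ?sube0// subee.
Qed.

Lemma time_measureT_lty T : (time_measure T setT < +oo)%E.
Proof.
rewrite time_measureE setTI.
have := lebesgue_measure_itv `]0, T[; rewrite /= => ->.
by case: ifP => // _; rewrite -EFinB ltry.
Qed.

(** Both sides are measures that agree on half-open intervals, which characterizes Lebesgue
    measure. *)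
Lemma lebesgue_measure_shift h A : measurable A ->
  pushforward lebesgue_measure ((+%R h) : _ -> measurableTypeR R) A =
  lebesgue_measure A.
Proof.
move=> mA.
have mh : measurable_fun setT ((+%R h) : measurableTypeR R -> measurableTypeR R).
  exact: measurable_funD.
apply/esym; apply: (@lebesgue_measure_unique _
  (@measure_function_pushforward__canonical__measure_function_Measure
        _ _ _ _ _ (@lebesgue_measure R) _ mh)) => //= _ [[a b]] _ <-.
rewrite /pushforward.
rewrite (_ : _ @^-1` _ = [set` `]a - h, b - h] ]); last first.
  by apply/seteqP; split => x /=; rewrite !in_itv/= ltrBlDl lerBrDl.
rewrite !lebesgue_measure_itv/= !lte_fin ltrD2r -!EFinB.
by case: ifP => // _; congr EFin; ring.
Qed.

(** Translation by [h] identifies the horizon [T - h] with the times after [h] in the horizon [T].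
    This is how the initial part of a control is discarded. *)
Lemma time_measure_shift T h A : 0 <= h -> measurable A ->
  time_measure (T - h) ((+%R h) @^-1` A) =
  time_measure T (A `&` [set` `]h, +oo[]).
Proof.
move=> h0 mA; rewrite !time_measureE.
have mB : measurable (A `&` [set` `]h, +oo[] `&` [set` `]0, T[] : set (measurableTypeR R)).
  apply: measurableI; last exact: measurable_itv.
  by apply: measurableI => //; exact: measurable_itv.
rewrite -(lebesgue_measure_shift h mB).
congr lebesgue_measure; apply/seteqP; split => x /=; rewrite !in_itv/= andbT.
  by move=> [Ax /andP[x0 xT]]; repeat split => //; rewrite ?in_itv/=; lra.
by move=> [[Ax hx] /andP[x0 xT]]; split => //; lra.
Qed.

Lemma ae_time_measure T :
  {ae time_measure T, forall t : measurableTypeR R, 0 < (t : R) < T}.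
Proof.
exists (~` [set` `]0, T[]); split; first by apply: measurableC.
  by rewrite time_measureE setICl measure0.
by move=> t /= h; rewrite in_itv.
Qed.

Lemma ae_time_measure_shift T h (P : measurableTypeR R -> Prop) : 0 <= h ->
  {ae time_measure T, forall t, P t} ->
  {ae time_measure (T - h), forall t : measurableTypeR R, P (h + t)}.
Proof.
move=> h0 [N [mN N0 PN]]; exists ((+%R h) @^-1` N); split.
- by rewrite -[X in measurable X]setTI; apply: measurable_funD.
- apply: (eq_trans (time_measure_shift T h0 mN)).
  apply/eqP; rewrite -measure_le0 -N0; apply: le_measure; rewrite ?inE//.
  by apply: measurableI => //; exact: measurable_itv.
- by move=> t /= nP; exact: PN.
Qed.

End time_measure.

(** * Null sets of a product measure *)

Section product_ae.
Context (R : realType) d1 (Y : measurableType d1) d2 (X : measurableType d2).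
Variables (nu : {measure set Y -> \bar R}) (mu : {finite_measure set X -> \bar R}).

(** The measure of a set is the integral of the measures of its sections; if it is 0, almost every
    section is null. *)
Lemma product_ae (P : Y * X -> Prop) : {ae (nu \x mu)%E, forall z, P z} ->
  {ae nu, forall t, {ae mu, forall x, P (t, x)}}.
Proof.
move=> [N [mN N0 PN]].
have m0 : measurable_fun setT (mu \o xsection N) by exact: measurable_fun_xsection.
have : (\int[nu]_t `|(mu \o xsection N) t| = 0)%E.
  by under eq_integral do rewrite gee0_abs//.
move=> /(ae_eq_integral_abs nu measurableT m0).
apply: filterS => t /(_ Logic.I)/= h; exists (xsection N t); split => //.
  exact: measurable_xsection.
by move=> x /= nP; rewrite /xsection/= inE; apply: PN.
Qed.

Lemma ae_product (P : Y * X -> Prop) : measurable [set z | P z] ->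
  {ae nu, forall t, {ae mu, forall x, P (t, x)}} ->
  {ae (nu \x mu)%E, forall z, P z}.
Proof.
move=> mP h.
exists (~` [set z | P z]); split => //; first exact: measurableC.
rewrite /product_measure1.
have mC : measurable (~` [set z | P z]) by exact: measurableC.
have m0 : measurable_fun setT (mu \o xsection (~` [set z | P z])).
  exact: measurable_fun_xsection.
rewrite (_ : 0 = \int[nu]_x cst 0 x)%E; last by rewrite integral0.
apply: ae_eq_integral => //.
apply: filterS h => t [N [mN N0 PN]] _ /=.
apply/eqP; rewrite -measure_le0 -N0; apply: le_measure; rewrite ?inE//.
  exact: measurable_xsection.
by move=> x; rewrite /xsection/= inE => nP; exact: PN.
Qed.

Lemma product_measureT_lty : (nu setT < +oo)%E -> ((nu \x mu)%E setT < +oo)%E.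
Proof.
move=> nufin; rewrite -setXTT product_measure1E//.
by rewrite lte_mul_pinfty//; [rewrite ge0_fin_numE|exact: fin_num_fun_lty].
Qed.

End product_ae.

(** * Cost bounds as pointwise bounds on controls *)

Section control_bounds.
Context (R : realType) d (X : measurableType d).
Variables (mu : {finite_measure set X -> \bar R}) (L : R).
Local Notation c := ((L * fine (mu setT))^-1).

(** For [0 <= a] and [0 < T] this expresses [FT L u <= a ^+ 2 / 2]: the essential supremum and the
    sign penalty become inequalities for almost every time. *)
Definition ctrl_bounded T (u : controls mu T) (a : R) : Prop :=
  {ae time_measure T, forall t, {ae mu, forall x, (0 <= u (t, x) <= a)%R} /\
    ('N[mu]_1[(fun x => (u (t, x))%:E)] * c%:E <= a%:E)%E}.

Lemma measurable_slice (v : measurableTypeR R * X -> R) t :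
  measurable_fun setT v -> measurable_fun setT (fun x => v (t, x)).
Proof. by move=> mv; exact: measurableT_comp. Qed.

(** A bounded slice is square-integrable because [mu] is finite, so [insubd] does not return its
    default 0. *)
Lemma sliceE T (u : controls mu T) t a :
  {ae mu, forall x, (`|u (t, x)| <= a)%R} ->
  slice u t = (fun x => u (t, x)) :> (X -> R).
Proof.
move=> ua.
have [||g gE] := @L2_bounded _ _ _ mu (fun x => u (t, x)) a _ _ ua.
- exact: fin_num_fun_lty.
- by apply: measurable_slice; exact: measurable_funPT.
rewrite /slice -gE; have : val (insubd (0 : L2 mu) (val g)) = val g.
  by rewrite insubdK//; exact: LfunP.
by [].
Qed.

Lemma ctrl_of_bounded T (v : measurableTypeR R * X -> R) (a : R) :
  measurable_fun setT v ->
  {ae time_measure T, forall t, {ae mu, forall x, (`|v (t, x)| <= a)%R}} ->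
  exists u : controls mu T, u = v :> (_ -> R).
Proof.
move=> mv va; apply: (@L2_bounded _ _ _ _ _ a) => //.
  by apply: product_measureT_lty; exact: time_measureT_lty.
apply: (@ae_product _ _ _ _ _ _ _ (fun z => (`|v z| <= a)%R)) => //.
rewrite (_ : mkset _ = setT `&` (fun z => `|v z|) @^-1` [set` `]-oo, a] ]).
  by apply: measurableT_comp => //; exact: measurable_itv.
by rewrite setTI; apply/seteqP; split => z /=; rewrite in_itv.
Qed.

Lemma bounded_Linfty (f : X -> R) (a : R) : (0 <= a)%R ->
  {ae mu, forall x, (`|f x| <= a)%R} <-> ('N[mu]_+oo[EFin \o f] <= a%:E)%E.
Proof.
move=> a0; rewrite unlock /Lnorm; case: ifPn => mu0.
  split => [h|/ess_supP h]; first by apply/ess_supP; apply: filterS h.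
  by apply: filterS h => x /=.
(* Here [mu] is the zero measure: the norm is 0 by definition and every property holds almost
   everywhere. *)
split => // _; exists setT; split => //.
by apply/eqP; rewrite -measure_le0 leNgt.
Qed.

Definition ctrl_size T (u : controls mu T) (t : R) : \bar R :=
  (maxe 'N[mu]_+oo[(fun x => (u (t, x))%:E)]
       ('N[mu]_1[(fun x => (u (t, x))%:E)] * c%:E))%E.

Lemma ctrl_size_ge0 T (u : controls mu T) t : (0 <= ctrl_size u t)%E.
Proof. by rewrite le_max Lnorm_ge0. Qed.

Lemma expe2_le (x : \bar R) (a : R) : (0 <= x)%E -> (0 <= a)%R ->
  (x ^+ 2 <= (a ^+ 2)%:E)%E = (x <= a%:E)%E.
Proof.
rewrite expe2; case: x => [r r0 a0||//].
  by rewrite -EFinM -expr2 !lee_fin ler_pXn2r// nnegrE -lee_fin.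
by move=> _ a0; rewrite mulyy !leye_eq.
Qed.

(** A finite cost excludes the penalty. Since [0 < T], the time measure is nonzero and the essential
    supremum is nonnegative, so adding the penalty [+oo] does give [+oo]. *)
Lemma FT_nonneg T (u : controls mu T) : 0 < T ->
  (FT L u < +oo)%E -> {ae (time_measure T \x mu)%E, forall z, (0 <= u z)%R} /\
  FT L u = ((2^-1)%:E * ess_sup (time_measure T) (fun t => ctrl_size u t ^+ 2))%E.
Proof.
move=> T0; rewrite /FT; case: ifPn => [/asboolP h _|_].
  by rewrite adde0.
have : (0 <= ess_sup (time_measure T) (fun t => ctrl_size u t ^+ 2))%E.
  apply: ess_sup_gee; first by rewrite time_measureT ?lte_fin// ltW.
  by apply: nearW => t; rewrite expe_ge0// ctrl_size_ge0.
rewrite /ctrl_size => h; rewrite addey ?ltxx//.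
by rewrite -ltNye (lt_le_trans ltNy0)// mule_ge0.
Qed.

Lemma FT_ge0 T (u : controls mu T) : 0 < T -> (0 <= FT L u)%E.
Proof.
move=> T0; have [fy|] := ltP (FT L u) +oo%E; last by rewrite leye_eq => /eqP ->.
have [_ ->] := FT_nonneg T0 fy; apply: mule_ge0 => //.
apply: ess_sup_gee; first by rewrite time_measureT ?lte_fin// ltW.
by apply: nearW => t; rewrite expe_ge0// ctrl_size_ge0.
Qed.

Lemma FT_le_bounded T (u : controls mu T) (l : R) : 0 < T ->
  (FT L u <= l%:E)%E -> 0 <= l /\ ctrl_bounded u (Num.sqrt (2 * l)).
Proof.
move=> T0 ul.
have l0 : 0 <= l by rewrite -lee_fin (le_trans (FT_ge0 _ T0) ul).
split => //; have [pos E] := FT_nonneg T0 (le_lt_trans ul (ltry _)).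
move: ul; rewrite E -lee_pdivlMl// invrK -EFinM => /ess_supP.
have -> : 2 * l = Num.sqrt (2 * l) ^+ 2 by rewrite sqr_sqrtr// mulr_ge0.
have s0 := sqrtr_ge0 (2 * l); set a := Num.sqrt _ in s0 *.
rewrite sqrtr_sqr ger0_norm// => h; move/product_ae in pos.
apply: filterS2 pos h => t pos; rewrite expe2_le ?ctrl_size_ge0// ge_max => /andP[h1 h2].
split => //; have /(bounded_Linfty _ s0) h := h1.
by apply: filterS2 pos h => x -> /= /(le_trans (ler_norm _)).
Qed.

Lemma bounded_FT_le T (u : controls mu T) (a : R) : 0 <= a ->
  ctrl_bounded u a -> (FT L u <= (a ^+ 2 / 2)%:E)%E.
Proof.
move=> a0 ua; rewrite /FT; case: ifPn => [_|/asboolP].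
  rewrite adde0 -lee_pdivlMl// invrK -EFinM (_ : 2 * _ = a ^+ 2); last by field.
  apply/ess_supP; apply: filterS ua => t [h1 h2].
  rewrite -/(ctrl_size u t) expe2_le ?ctrl_size_ge0// ge_max h2 andbT.
  apply/(bounded_Linfty _ a0); apply: filterS h1 => x /andP[x0 xa].
  by rewrite ger0_norm.
case; apply: (@ae_product _ _ _ _ _ _ _ (fun z => (0 <= u z)%R)).
  rewrite (_ : mkset _ = setT `&` u @^-1` [set` `[0, +oo[ ]).
    by apply: measurable_funPT => //; exact: measurable_itv.
  by rewrite setTI; apply/seteqP; split => z /=; rewrite in_itv/= andbT.
by apply: filterS ua => t [h1 _]; apply: filterS h1 => x /andP[].
Qed.

(** The pointwise bounds add up directly, the L^1 bounds by Minkowski's inequality. *)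
Lemma ctrl_bounded_convex T (u v : controls mu T) (a b r s : R) :
  0 <= r -> 0 <= s -> ctrl_bounded u a -> ctrl_bounded v b -> 0 <= c ->
  ctrl_bounded (r *: u + s *: v) (r * a + s * b).
Proof.
move=> r0 s0 ua vb c0; apply: filterS2 ua vb => t [u1 u2] [v1 v2]; split.
  apply: filterS2 u1 v1 => x /andP[u0 ua] /andP[v0 vb].
  change (0 <= r * u (t, x) + s * v (t, x) <= r * a + s * b)%R.
  by rewrite addr_ge0 ?mulr_ge0//= lerD// ler_wpM2l.
have mu' : measurable_fun setT (fun x => u (t, x)).
  by apply: measurable_slice; exact: measurable_funPT.
have mv' : measurable_fun setT (fun x => v (t, x)).
  by apply: measurable_slice; exact: measurable_funPT.
have N1Z (f : X -> R) (k : R) : measurable_fun setT f -> 0 <= k ->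
    ('N[mu]_1[EFin \o (k \*: f)] = k%:E * 'N[mu]_1[EFin \o f])%E.
  move=> mf k0; rewrite !Lnorm1 -ge0_integralZl//.
    by apply: eq_integral => x _ /=; rewrite normrM ger0_norm// EFinM.
  by apply/measurable_EFinP; exact: measurableT_comp.
apply: (@le_trans _ _ ((r%:E * 'N[mu]_1[EFin \o (fun x => u (t, x))] +
    s%:E * 'N[mu]_1[EFin \o (fun x => v (t, x))]) * c%:E)%E).
  apply: lee_wpmul2r; first by rewrite lee_fin.
  rewrite -!N1Z//; apply: (@eminkowski _ _ _ mu (r \*: (fun x => u (t, x)))
    (s \*: (fun x => v (t, x))) 1%E) => //; exact: measurable_funM.
rewrite ge0_muleDl ?mule_ge0 ?Lnorm_ge0 ?lee_fin//.
have -> : (r * a + s * b)%:E = (r%:E * a%:E + s%:E * b%:E)%E by rewrite -!EFinM.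
by rewrite -!muleA leeD// lee_wpmul2l ?lee_fin.
Qed.

End control_bounds.

(** * Positive semigroups *)

Section nonnegative_L2.
Context (R : realType) d (X : measurableType d).
Variable mu : {finite_measure set X -> \bar R}.

Lemma L2dot_ge0 (f g : L2 mu) : L2nneg f -> L2nneg g -> 0 <= L2dot f g.
Proof.
move=> f0 g0; rewrite /L2dot /Rintegral fine_ge0//.
rewrite (_ : integral _ _ _ = \int[mu]_x `|f x * g x|%:E)%E.
  by apply: integral_ge0 => x _; rewrite lee_fin.
apply: ae_eq_integral => //.
- exact: measurable_int (L2dot_integrable f g).
- exact: measurable_int (integrable_norm (L2dot_integrable f g)).
- by apply: filterS2 f0 g0 => x f0 g0 _; rewrite ger0_norm// mulr_ge0.
Qed.

(** Truncate [y] at height [n] and apply dominated convergence with majorant [y ^+ 2]. Taking the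
    maximum with 0 makes the bounds hold at every point, also on the null set where [y] is
    negative. *)
Lemma L2nneg_bounded_approx (y : L2 mu) (e : R) : L2nneg y -> 0 < e ->
  exists (f : L2 mu) (B : R),
    [/\ 0 <= B, forall x, 0 <= f x <= B & nrm (f - y) <= e].
Proof.
move=> y0 e0.
have my := measurable_L2 y.
have /choice[f fE] (n : nat) : exists g : L2 mu,
    g = (fun x => Num.min (Num.max (y x) 0) n%:R) :> (X -> R).
  apply: (@L2_bounded _ _ _ _ _ n%:R); first exact: fin_num_fun_lty.
    by apply: measurable_minr => //; apply: measurable_maxr.
  apply: nearW => x; rewrite ger0_norm; first by rewrite ge_min lexx orbT.
  by rewrite le_min ler0n le_max lexx orbT.
suff : nrm (f n - y) @[n --> \oo] --> 0.
  move=> /cvgrPdist_le/(_ _ e0)[n _ /(_ n (leqnn _))].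
  rewrite sub0r normrN ger0_norm ?nrm_ge0// => fn; exists (f n), n%:R; split => // x.
  rewrite fE; apply/andP; split; first by rewrite le_min ler0n le_max lexx orbT.
  by rewrite ge_min lexx orbT.
pose h n x := ((f n x - y x) ^+ 2)%:E.
have mh n : measurable_fun setT (h n).
  by apply/measurable_EFinP; apply: measurable_funX; exact: (measurable_L2 (f n - y)).
have [|||_ _] := @dominated_convergence _ _ _ mu setT measurableT
  h (cst 0%E) (fun x => ((y x) ^+ 2)%:E) mh (measurable_cst _).
- apply: filterS y0 => x y0 _; apply: cvg_near_cst.
  have [N _ NP] : \forall n \near \oo, y x <= n%:R by exact: nbhs_infty_ger.
  exists N => // n /= Nn; rewrite /h /= fE.
  by rewrite (max_l y0) min_l ?subrr ?expr0n//; exact: NP.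
- apply/integrableP; split.
    by apply/measurable_EFinP; apply: measurable_funX.
  under eq_integral do rewrite gee0_abs ?lee_fin ?sqr_ge0//.
  by rewrite -sqr_nrm ltry.
- apply: filterS y0 => x y0 n _; rewrite /h /= ger0_norm ?sqr_ge0// lee_fin.
  rewrite fE (max_l y0) -sqrrN opprB ler_pXn2r// ?nnegrE//.
    by rewrite gerBl le_min y0 ler0n.
  by rewrite subr_ge0 ge_min lexx.
rewrite integral0 => hcvg.
have hE n : (\int[mu]_x h n x)%E = (nrm (f n - y) ^+ 2)%:E by rewrite sqr_nrm.
have {}hcvg : (nrm (f n - y) ^+ 2)%:E @[n --> \oo] --> 0%E.
  by under eq_fun do rewrite -hE.
have {}hcvg : (nrm (f n - y) ^+ 2) @[n --> \oo] --> 0.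
  by have /fine_cvgP[_] := hcvg.
apply/cvgrPdist_le => r r0; have r2 : 0 < r ^+ 2 by rewrite exprn_gt0.
move/cvgrPdist_le/(_ _ r2) : hcvg; apply: filterS => n.
rewrite !sub0r !normrN ger0_norm ?sqr_ge0// ger0_norm ?nrm_ge0//.
by rewrite ler_pXn2r// nnegrE ?nrm_ge0// ltW.
Qed.

End nonnegative_L2.

(** * Positivity and continuity of the semigroup *)

Section semigroup.
Context (R : realType) d (X : measurableType d).
Variable mu : {finite_measure set X -> \bar R}.
Context (S Sadj : R -> L2 mu -> L2 mu) (S_C0 : C0_semigroup S).
Context (S_adj : forall t : R, 0 <= t -> adjoint (S t) (Sadj t)).
Context (Sadj_pos : comparison_principle Sadj).

Lemma semigroup_bounded t : 0 <= t ->
  exists2 K, 0 <= K & forall f, nrm (S t f) <= K * nrm f.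
Proof.
move=> t0; have [K KP] := C0_bounded S_C0 t0.
exists (Num.max K 0); first by rewrite le_max lexx orbT.
move=> f; apply: (@le_trans _ _ (K * nrm f)).
  by rewrite -lee_fin EFinM -!L2normE.
by rewrite ler_wpM2r ?nrm_ge0// le_max lexx.
Qed.

Lemma semigroup0 t : 0 <= t -> L2eq (S t 0) 0.
Proof.
move=> t0; apply: nrm_sub_eq0; rewrite subr0.
have [K _ /(_ 0)] := semigroup_bounded t0; rewrite nrm0 mulr0 => h.
by apply/eqP; rewrite eq_le h nrm_ge0.
Qed.

Lemma semigroupZ t a f : 0 <= t -> L2eq (S t (a *: f)) (a *: S t f).
Proof.
move=> t0; rewrite -[a *: f]addr0.
apply: L2eq_trans (C0_linear S_C0 _ _ _ t0) _.
rewrite -[X in L2eq _ X]addr0; apply: L2eqD; first exact: L2eq_refl.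
exact: semigroup0.
Qed.

Lemma semigroupB t f g : 0 <= t -> L2eq (S t (f - g)) (S t f - S t g).
Proof.
move=> t0; rewrite addrC -scaleN1r.
apply: L2eq_trans (C0_linear S_C0 _ _ _ t0) _.
by rewrite scaleN1r addrC; exact: L2eq_refl.
Qed.

(* Test [S t y] against its own negative part. *)
Lemma semigroup_nneg t y : 0 < t -> L2nneg y -> L2nneg (S t y).
Proof.
move=> t0 y0; set f := S t y.
have [||z zE] := @L2_of_sqr_integrable _ _ _ mu (fun x => Num.max (- f x) 0).
- apply: measurable_maxr => //; apply: measurableT_comp => //; exact: measurable_L2.
- apply: (@le_lt_trans _ _ (\int[mu]_x ((f x) ^+ 2)%:E)%E).
    apply: ge0_le_integral => //.
    + by move=> x _; rewrite lee_fin sqr_ge0.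
    + apply/measurable_EFinP; apply: measurable_funX; apply: measurable_maxr => //.
      by apply: measurableT_comp => //; exact: measurable_L2.
    + by apply/measurable_EFinP; apply: measurable_funX; exact: measurable_L2.
    + move=> x _; rewrite lee_fin maxEle; case: ifP => h; last by rewrite sqrrN.
      by rewrite expr0n sqr_ge0.
  by rewrite -sqr_nrm ltry.
have z0 : L2nneg z by apply: nearW => x; rewrite zE le_max lexx orbT.
have : 0 <= L2dot f z.
  by rewrite /f (S_adj (ltW t0)); apply: L2dot_ge0 => //; exact: Sadj_pos.
(* The function [z] is [- f] where [f] is negative and 0 elsewhere. Hence
   [0 <= L2dot f z = - nrm z ^+ 2], and [z] vanishes. *)
have -> : L2dot f z = - L2dot z z.
  rewrite -[RHS]mulN1r -L2dotZl; apply: eq_Rintegral => x _.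
  rewrite L2scaleE zE mulN1r maxEle; case: ifP => h; last by rewrite opprK.
  by rewrite oppr0 mul0r mulr0.
rewrite L2dotff oppr_ge0 exprn_even_le0//= => /eqP nz.
have /nrm_sub_eq0 : nrm (z - 0) = 0 by rewrite subr0.
apply: filterS => x /(_ Logic.I); rewrite zE L2zeroE => h.
by rewrite -oppr_le0 -h le_max lexx.
Qed.

Lemma semigroup_le (t a : R) (f g : L2 mu) : 0 < t ->
  {ae mu, forall x, f x <= a * g x} ->
  {ae mu, forall x, S t f x <= a * S t g x}.
Proof.
move=> t0 fg.
have /(semigroup_nneg t0) h : L2nneg (a *: g - f).
  by apply: filterS fg => x fg; rewrite L2addE L2oppE L2scaleE subr_ge0.
have t0' := ltW t0.
apply: filterS (filterI h (filterI (semigroupB (a *: g) f t0') (semigroupZ a g t0'))).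
move=> x [/= h1 [/(_ Logic.I) h2 /(_ Logic.I) h3]].
move: (h1); rewrite h2 => h4.
have {}h4 : 0 <= S t (a *: g) x - S t f x by exact: h4.
by rewrite h3 in h4; rewrite -subr_ge0.
Qed.

(** By positivity [S t f] lies between 0 and [a *: S t g]. With [g] the constant 1, a single orbit
    controls all bounded controls. *)
Lemma nrm_semigroup_le (t a : R) (f g : L2 mu) : 0 < t ->
  {ae mu, forall x, 0 <= f x <= a * g x} -> 0 <= a ->
  nrm (S t f) <= a * nrm (S t g).
Proof.
move=> t0 fg a0; rewrite -[a in leRHS]ger0_norm// -nrmZ; apply: le_nrm.
have f0 : L2nneg f by apply: filterS fg => x /andP[].
have /(semigroup_le t0) : {ae mu, forall x, f x <= a * g x}.
  by apply: filterS fg => x /andP[].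
apply: filterS2 (semigroup_nneg t0 f0) => x Sf0 Sfg.
by rewrite L2scaleE !ger0_norm// (le_trans Sf0).
Qed.

Lemma semigroup_cvg0 f e : 0 < e ->
  exists2 r, 0 < r & forall t, 0 <= t -> t <= r -> nrm (S t f - f) <= e.
Proof.
move=> e0; have /L2norm_cvg0 := C0_cvg S_C0 f.
move=> /cvgrPdist_le/(_ _ e0)[r /= r0 rP].
exists (r / 2); first exact: divr_gt0.
(* The limit at [0^'+] says nothing about [t = 0], where [C0_id] is used instead. *)
move=> t; rewrite le_eqVlt => /predU1P[<- _|t0 tr].
  rewrite (_ : nrm _ = 0) ?ltW// -[RHS](nrm0 mu); apply: nrm_eq.
  have : L2eq (S 0 f - f) (f - f).
    by apply: L2eqD; [exact: C0_id|exact: L2eq_refl].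
  by rewrite subrr.
have := rP t; rewrite /ball/= sub0r normrN (gtr0_norm t0) => /(_ _ t0).
rewrite sub0r normrN ger0_norm ?nrm_ge0//; apply.
by rewrite (le_lt_trans tr)// ltr_pdivrMr// ltr_pMr// ltr1n.
Qed.

(* Iterating [S r] replaces the uniform boundedness principle, at the price of a
   bound which depends on [f]. *)
Lemma semigroup_locally_bounded f (T : R) :
  exists2 C, 0 <= C & forall t, 0 <= t <= T -> nrm (S t f) <= C.
Proof.
have [r r0 rP] := semigroup_cvg0 f ltr01.
have [K K0 KP] := semigroup_bounded (ltW r0).
have step n : exists2 C, 0 <= C & forall t, 0 <= t <= n%:R * r -> nrm (S t f) <= C.
  elim: n => [|n [C C0 CP]].
    exists (nrm f); first exact: nrm_ge0.
    move=> t; rewrite mul0r => /le_anti <-.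
    by rewrite (nrm_eq (C0_id S_C0 f)).
  exists (nrm f + 1 + K * C); first by rewrite !addr_ge0 ?nrm_ge0// mulr_ge0.
  move=> t /andP[t0 tn]; have [tr|rt] := leP t r.
    rewrite (le_trans (nrm_le_sub _ f))// -addrA lerD2l.
    by rewrite (le_trans (rP _ t0 tr))// lerDl mulr_ge0.
  have tr0 : 0 <= t - r by rewrite subr_ge0 ltW.
  have := C0_comp S_C0 f (ltW r0) tr0; rewrite addrC subrK => /nrm_eq ->.
  rewrite (le_trans (KP _))// (le_trans (ler_wpM2l K0 (CP (t - r) _)))//; last first.
    by rewrite lerDr !addr_ge0// nrm_ge0.
  by rewrite tr0 lerBlDr -[X in _ + X]mul1r -mulrDl natr1.
have [N _ NP'] : \forall n \near \oo, T / r <= n%:R by exact: nbhs_infty_ger.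
have NP := NP' N (leqnn N).
have [C C0 CP] := step N; exists C => // t /andP[t0 tT]; apply: CP.
by rewrite t0 (le_trans tT)// -ler_pdivrMr.
Qed.

(** Apply the bounded operator [S t] to [S h f - f], which is small by continuity at 0. *)
Lemma semigroup_right_continuous f t e : 0 <= t -> 0 < e ->
  exists2 r, 0 < r & forall h, 0 <= h -> h <= r -> nrm (S (t + h) f - S t f) <= e.
Proof.
move=> t0 e0; have [K K0 KP] := semigroup_bounded t0.
have K1 : 0 < K + 1 by rewrite ltr_wpDl.
have [r r0 rP] := semigroup_cvg0 f (divr_gt0 e0 K1).
exists r => // h h0 hr.
have -> : nrm (S (t + h) f - S t f) = nrm (S t (S h f - f)).
  apply: nrm_eq; apply: L2eq_trans (L2eq_sym (semigroupB _ _ t0)).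
  by apply: L2eqD; [exact: C0_comp|exact: L2eq_refl].
rewrite (le_trans (KP _))// (le_trans (ler_wpM2l K0 (rP _ h0 hr)))//.
by rewrite mulrA ler_pdivrMr// [leRHS]mulrC ler_wpM2r ?lerDl// ltW.
Qed.

End semigroup.

(** * Riemann sums and averages of an orbit *)

Section orbit.
Context (R : realType) d (X : measurableType d).
Variable mu : {finite_measure set X -> \bar R}.
Context (S : R -> L2 mu -> L2 mu) (S_C0 : C0_semigroup S).

(** In terms of the remaining time [T - t], step [k] runs from [k%:R * c] included to [k.+1%:R * c]
    excluded. The orbit is sampled at the upper end, so that right continuity suffices for
    convergence. *)
Definition orbit_step (T c : R) (k : nat) : set (measurableTypeR R) :=
  [set` `]T - k.+1%:R * c, T - k%:R * c] ].

Definition orbit_simple (f : L2 mu) (T c : R) (n : nat) :=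
  [seq (orbit_step T c k, S (k.+1%:R * c) f) | k <- iota 0 n].

Lemma orbit_simple_ok (f : L2 mu) (T c : R) n
    (nu : {measure set (measurableTypeR R) -> \bar R}) :
  (nu setT < +oo)%E -> simple_ok nu (orbit_simple f T c n).
Proof.
move=> nufin _ /mapP[k _ ->] /=; split; first exact: measurable_itv.
apply: le_lt_trans nufin; apply: le_measure; rewrite ?inE//; exact: measurable_itv.
Qed.

Lemma orbit_simple_in (f : L2 mu) (T c : R) n t :
  0 < c -> 0 <= T - t -> T - t < n%:R * c ->
  exists2 k : nat, k%:R * c <= T - t < k.+1%:R * c &
    (k < n)%N /\ L2simple (orbit_simple f T c n) t = S (k.+1%:R * c) f.
Proof.
move=> c0 t0 tn; pose k0 := Num.truncn ((T - t) / c).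
have q0 : 0 <= (T - t) / c by rewrite divr_ge0// ltW.
have /andP[k1 k2] : k0%:R * c <= T - t < k0.+1%:R * c.
  by have := truncn_itv q0; rewrite ler_pdivlMr// ltr_pdivrMr.
have stepP k : (t \in orbit_step T c k) = (k == k0).
  apply/idP/idP.
    rewrite inE /orbit_step/= in_itv/= => /andP[h1 h2].
    have h3 : k%:R * c < k0.+1%:R * c by lra.
    have h4 : k0%:R * c < k.+1%:R * c by lra.
    rewrite !ltr_pM2r// !ltr_nat !ltnS in h3 h4.
    by rewrite eqn_leq h3 h4.
  move=> /eqP ->; rewrite inE /orbit_step/= in_itv/=.
  by apply/andP; split; lra.
have kn : (k0 < n)%N.
  by have := le_lt_trans k1 tn; rewrite ltr_pM2r// ltr_nat.
exists k0; [by rewrite k1 k2|split => //].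
rewrite /L2simple big_map (bigD1_seq k0) ?iota_uniq//= ?mem_iota ?add0n//.
rewrite indicE stepP eqxx scale1r big1 ?addr0// => k /negbTE kk0.
by rewrite indicE stepP kk0 scale0r.
Qed.

Lemma orbit_simple_out (f : L2 mu) (T c : R) n t : 0 < c -> n%:R * c <= T - t ->
  L2simple (orbit_simple f T c n) t = 0.
Proof.
move=> c0 tn; rewrite /L2simple big_map big_seq big1// => k.
rewrite mem_iota add0n => /andP[_ kn] /=.
rewrite indicE memNset ?scale0r// /orbit_step/= in_itv/= => /andP[h1 _].
have : k.+1%:R * c <= n%:R * c by rewrite ler_pM2r// ler_nat.
lra.
Qed.

Lemma time_measure_end (T dl : R) : 0 < dl -> dl <= T ->
  time_measure T [set` `]T - dl, T[] = dl%:E.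
Proof.
move=> dl0 dlT; rewrite time_measureE (setIidl _); last first.
  by move=> x /=; rewrite !in_itv/= => /andP[h1 ->]; rewrite andbT; lra.
have := lebesgue_measure_itv `]T - dl, T[; rewrite /= => ->.
by rewrite lte_fin gtrBl dl0 -EFinB; congr EFin; ring.
Qed.

Lemma is_bochner_indic d' (Y : measurableType d')
    (nu : {measure set Y -> \bar R}) (E : set Y) (f : L2 mu) :
  measurable E -> (nu E < +oo)%E ->
  is_bochner nu (fun t => (\1_E t : R) *: f) (fine (nu E) *: f).
Proof.
move=> mE Efin.
have sE t : L2simple [:: (E, f)] t = (\1_E t : R) *: f.
  by rewrite /L2simple big_seq1.
apply: (@majorized_is_bochner _ _ _ _ _ _ nu _
  (fun _ => [:: (E, f)]) (fun _ => cst 0%E)).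
  split => //.
  - by move=> n p; rewrite inE => /eqP ->.
  - apply: nearW => t; split=> [n|]; first by rewrite sE subrr nrm0.
    under eq_fun do rewrite sE subrr nrm0; exact: cvg_cst.
  - by under eq_fun do rewrite integral0; exact: cvg_cst.
rewrite /L2simple_integral big_seq1/= subrr nrm0; exact: cvg_cst.
Qed.

(** The Riemann sums converge pointwise by right continuity and stay at bounded distance from the
    orbit, so the integral exists. Comparison with the integral of the constant [f] over the same
    interval bounds the average. *)
Lemma is_bochner_orbit (f : L2 mu) (T dl e : R) : 0 < dl -> dl <= T ->
  (forall t, 0 <= t -> t <= dl -> nrm (S t f - f) <= e) ->
  exists w, is_bochner (time_measure T)
      (fun t => (\1_[set` `]T - dl, T[] t : R) *: S (T - t) f) w /\
    nrm (dl^-1 *: w - f) <= e.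
Proof.
move=> dl0 dlT Se.
have e0 : 0 <= e by apply: le_trans (nrm_ge0 _) (Se 0 (lexx _) (ltW dl0)).
set E := [set` `]T - dl, T[].
pose c n : R := dl / n.+1%:R.
have c0 n : 0 < c n by exact: divr_gt0.
have nc n : n.+1%:R * c n = dl by rewrite /c mulrC divfK.
have [w bw] : exists w, is_bochner (time_measure T)
    (fun t => (\1_E t : R) *: S (T - t) f) w.
  (* The orbit and its samples are both within [e] of [f], whence the bound [e + e]. *)
  apply: (@bounded_is_bochner _ _ _ _ _ _ _ _
    (fun n => orbit_simple f T (c n) n.+1) (e + e)).
  - exact: time_measureT_lty.
  - by move=> n; apply: orbit_simple_ok; exact: time_measureT_lty.
  have := ae_time_measure T; apply: filterS => t /andP[t0 tT].
  have [tdl|dlt] := leP dl (T - t).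
    have z n : nrm ((\1_E t : R) *: S (T - t) f -
        L2simple (orbit_simple f T (c n) n.+1) t) = 0.
      rewrite orbit_simple_out ?nc// indicE memNset ?scale0r ?subrr ?nrm0//.
      by rewrite /E/= in_itv/= => /andP[h _]; lra.
    split; first by move=> n; rewrite z addr_ge0.
    by under eq_fun do rewrite z; exact: cvg_cst.
  have -> : (\1_E t : R) = 1.
    by rewrite indicE mem_set// /E/= in_itv/= tT andbT; lra.
  rewrite scale1r; have s0 : 0 <= T - t by lra.
  split.
    move=> n; have [|k /andP[k1 k2] [kn ->]] := @orbit_simple_in f T (c n) n.+1 t (c0 n) s0.
      by rewrite nc.
    apply: le_trans (nrm_triangle f _ _) _; apply: lerD.
      by apply: Se => //; exact: ltW.
    rewrite nrmB; apply: Se; first by rewrite mulr_ge0// ltW.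
    by rewrite -(nc n) ler_pM2r// ler_nat.
  apply/cvgrPdist_le => r r0.
  have [q q0 qP] := semigroup_right_continuous S_C0 f s0 r0.
  (* For such [n] the mesh [c n] is at most [q]. *)
  have [N _ NP] : \forall n \near \oo, dl / q <= n%:R by exact: nbhs_infty_ger.
  exists N => // n /= Nn; rewrite sub0r normrN ger0_norm ?nrm_ge0//.
  have [|k /andP[k1 k2] [kn ->]] := @orbit_simple_in f T (c n) n.+1 t (c0 n) s0.
    by rewrite nc.
  rewrite nrmB -[k.+1%:R * c n](subrKC (T - t)); apply: qP; first lra.
  have cq : c n <= q.
    rewrite /c ler_pdivrMr// mulrC -ler_pdivrMr// (le_trans (NP n Nn))//.
    by rewrite ler_nat.
  apply: le_trans cq; move: k1; rewrite -natr1 mulrDl mul1r; lra.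
exists w; split => //.
have mE : measurable E by exact: measurable_itv.
have nuE : time_measure T E = dl%:E by exact: time_measure_end.
have := @is_bochner_indic _ _ (time_measure T) E f mE.
rewrite nuE => /(_ (ltry _))/= bc.
have := is_bochner_lin 1 (-1) bw bc; rewrite scale1r scaleN1r => b.
have := @bochner_bound _ _ _ _ _ _ (time_measure T) _ _ (fun t => (e * \1_E t)%:E) b.
have -> : (\int[time_measure T]_t (e * \1_E t)%:E = (e * dl)%:E)%E.
  under eq_integral do rewrite EFinM.
  rewrite ge0_integralZl//; last by apply/measurable_EFinP; exact: measurable_indic.
  rewrite integral_indic// setIT.
  by rewrite nuE -EFinM.
rewrite lee_fin => h.
have -> : dl^-1 *: w - f = dl^-1 *: (w - dl *: f).
  by rewrite scalerBr scalerA mulVf ?scale1r// gt_eqF.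
rewrite nrmZ gtr0_norm ?invr_gt0// ler_pdivrMl// mulrC; apply: h.
- by apply/measurable_EFinP; apply: measurable_funM => //; exact: measurable_indic.
- by move=> t; rewrite lee_fin mulr_ge0.
have := ae_time_measure T; apply: filterS => t /andP[t0 tT].
rewrite scale1r scaleN1r -scalerBr nrmZ lee_fin [e * _]mulrC.
rewrite ger0_norm//; have [tE|tE] := boolP (t \in E); last first.
  by rewrite indicE (negbTE tE) !mul0r.
rewrite indicE tE !mul1r; move: tE; rewrite inE /E/= in_itv/= => /andP[h1 h2].
by apply: Se; lra.
Qed.

End orbit.

(** * Reachable states *)

Section reachability.
Context (R : realType) d (X : measurableType d).
Variable mu : {finite_measure set X -> \bar R}.
Context (S Sadj : R -> L2 mu -> L2 mu) (S_C0 : C0_semigroup S).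
Context (S_adj : forall t : R, 0 <= t -> adjoint (S t) (Sadj t)).
Context (Sadj_pos : comparison_principle Sadj).
Context (L : R) (L_gt0 : 0 < L).
Local Notation c := ((L * fine (mu setT))^-1).

Definition reaches T (u : controls mu T) (w : L2 mu) : Prop :=
  is_bochner (time_measure T) (fun t => S (T - t) (slice u t)) w.

(* The default value 0 of [LT] is not feasible, since [eps < nrm yf]. *)
Lemma feasibleP T (u : controls mu T) (eps : R) (yf : L2 mu) :
  eps < nrm yf ->
  feasible S eps yf u <-> exists2 w, reaches u w & nrm (w - yf) <= eps.
Proof.
move=> yfe; rewrite /feasible L2normE lee_fin; split.
  rewrite /LT /bochner; case: xgetP => [w _ bw wy|_]; first by exists w.
  by rewrite sub0r nrmN => /(lt_le_trans yfe); rewrite ltxx.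
move=> [w bw wy]; have : is_bochner (time_measure T)
    (fun t => S (T - t) (slice u t)) (LT S u) by exact: xgetI bw.
move=> b; rewrite (_ : nrm _ = nrm (w - yf))//; apply: nrm_eq.
apply: L2eqD; last exact: L2eq_refl.
by apply: is_bochner_unique b bw; apply: nearW => t; exact: L2eq_refl.
Qed.

Lemma ctrl_scale_ge0 : 0 <= c.
Proof. by rewrite invr_ge0 mulr_ge0// ?fine_ge0// ltW. Qed.

Lemma ctrl_bounded_slice T (u : controls mu T) a t :
  {ae mu, forall x, (0 <= u (t, x) <= a)%R} ->
  slice u t = (fun x => u (t, x)) :> (X -> R).
Proof.
move=> ua; apply: (@sliceE _ _ _ _ _ _ _ a); apply: filterS ua => x /andP[x0 xa].
by rewrite ger0_norm.
Qed.

(** The slice lies between 0 and [a] times the constant 1, so positivity bounds its image by [a]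
    times the orbit of 1. The constant [C] serves all horizons up to [Tm]. *)
Lemma ctrl_orbit_bound T Tm (u : controls mu T) (a C : R) (one : L2 mu) :
  one = cst 1 :> (X -> R) -> 0 <= a -> T <= Tm ->
  (forall t, 0 <= t <= Tm -> nrm (S t one) <= C) -> ctrl_bounded L u a ->
  {ae time_measure T, forall t : measurableTypeR R,
    nrm (S (T - (t : R)) (slice u t)) <= a * C}.
Proof.
move=> oneE a0 TTm CP ua; have := ae_time_measure T.
apply: filterS2 ua => t [ua _] /andP[t0 tT].
have Tt : 0 < T - t by lra.
apply: (@le_trans _ _ (a * nrm (S (T - t) one))).
  apply: (nrm_semigroup_le S_C0 S_adj Sadj_pos Tt) => //.
  by rewrite (ctrl_bounded_slice ua) oneE; apply: filterS ua => x; rewrite mulr1.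
by rewrite ler_wpM2l// CP// ltW//=; lra.
Qed.

Lemma reaches_small T Tm (u : controls mu T) (a C : R) (one w : L2 mu) :
  one = cst 1 :> (X -> R) -> 0 <= a -> 0 <= C -> 0 <= T -> T <= Tm ->
  (forall t, 0 <= t <= Tm -> nrm (S t one) <= C) -> ctrl_bounded L u a ->
  reaches u w -> nrm w <= a * C * T.
Proof.
move=> oneE a0 C0 T0 TTm CP ua uw; rewrite -lee_fin.
have := @bochner_bound _ _ _ _ _ _ (time_measure T) _ _ (cst (a * C)%:E) uw.
rewrite integral_cst// time_measureT//= -EFinM; apply => //.
  by move=> t; rewrite lee_fin mulr_ge0.
by have := ctrl_orbit_bound oneE a0 TTm CP ua; apply: filterS => t; rewrite lee_fin.
Qed.

(** The control is translated so that its first [h] units of time are lost. The state reached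
    changes by the integral over these times, which [ctrl_orbit_bound] controls. *)
Lemma reaches_truncate T Tm h (u : controls mu T) (a C : R) (one w : L2 mu) :
  one = cst 1 :> (X -> R) -> 0 <= a -> 0 <= C -> 0 <= h -> h <= T -> T <= Tm ->
  (forall t, 0 <= t <= Tm -> nrm (S t one) <= C) -> ctrl_bounded L u a ->
  reaches u w -> exists (v : controls mu (T - h)) (w' : L2 mu),
    [/\ ctrl_bounded L v a, reaches v w' & nrm (w' - w) <= a * C * h].
Proof.
move=> oneE a0 C0 h0 hT TTm CP ua uw.
pose phi : measurableTypeR R -> measurableTypeR R := +%R h.
have mphi : measurable_fun setT phi by exact: measurable_funD.
pose f (z : measurableTypeR R * X) : R := u (phi z.1, z.2).
have mf : measurable_fun setT f.
  apply: measurableT_comp => //; apply: measurable_fun_pair => //.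
  exact: measurableT_comp.
have ua' := ae_time_measure_shift h0 ua.
have [v vE] : exists v : controls mu (T - h), v = f :> (_ -> R).
  apply: (@ctrl_of_bounded _ _ _ _ _ _ a mf).
  apply: filterS ua' => t [ua' _]; apply: filterS ua' => x /andP[x0 xa].
  by rewrite /f/= ger0_norm.
pose E : set (measurableTypeR R) := [set` `]h, +oo[].
have mE : measurable E by exact: measurable_itv.
have [|w' [bw' bv]] := @is_bochner_restrict_comp _ _ _ _ _ _ _ _ _ _ _ _
  (time_measure (T - h)) phi mphi mE _ uw.
  by move=> A mA; exact: time_measure_shift.
exists v, w'; split.
- by apply: filterS ua' => t; rewrite vE.
(* Translation preserves the remaining time: [T - (h + t) = T - h - t]. *)
- rewrite /reaches (_ : (fun t => _) = (fun t => S (T - t) (slice u t)) \o phi)//.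
  apply/funext => t /=; rewrite /slice vE /phi; congr (S _ _).
  by rewrite opprD addrA.
rewrite nrmB; have := is_bochner_lin 1 (-1) uw bw'; rewrite scale1r scaleN1r => b.
have := @bochner_bound _ _ _ _ _ _ (time_measure T) _ _
  (fun t => (a * C * \1_(~` E) t)%:E) b.
have mCE : measurable (~` E) by exact: measurableC.
have nuE : time_measure T (~` E) = h%:E.
  (* The discarded times form []0, h[] if [h = T] and []0, h]] otherwise; both have length [h]. *)
  rewrite time_measureE; have := hT; rewrite le_eqVlt => /predU1P[<-|hT'].
    rewrite (setIidr _); last first.
      by move=> x /=; rewrite /E/= !in_itv/= andbT => /andP[x0 xh]; apply/negP; lra.
    have := lebesgue_measure_itv `]0, h[; rewrite /= => ->.
    by rewrite lte_fin; case: ltgtP h0 => // [_ _|<- _]; rewrite ?sube0.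
  rewrite (_ : _ `&` _ = [set` `]0, h] ]).
    have := lebesgue_measure_itv `]0, h]; rewrite /= => ->.
    by rewrite lte_fin; case: ltgtP h0 => // [_ _|<- _]; rewrite ?sube0.
  apply/seteqP; split => x /=; rewrite /E/= !in_itv/= andbT.
    by move=> [/negP h1 /andP[h2 h3]]; lra.
  by move=> /andP[h1 h2]; split; [apply/negP; lra|lra].
have -> : (\int[time_measure T]_t (a * C * \1_(~` E) t)%:E = (a * C * h)%:E)%E.
  under eq_integral do rewrite EFinM.
  rewrite ge0_integralZl ?lee_fin ?mulr_ge0//; last first.
    by apply/measurable_EFinP; exact: measurable_indic.
  by rewrite integral_indic// setIT nuE -EFinM.
rewrite lee_fin; apply.
- by apply/measurable_EFinP; apply: measurable_funM => //; exact: measurable_indic.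
- by move=> t; rewrite lee_fin !mulr_ge0.
have := ctrl_orbit_bound oneE a0 TTm CP ua; apply: filterS => t ht.
rewrite scale1r scaleN1r lee_fin !indicE in_setC.
case: (t \in E) => /=; last by rewrite scale0r subr0 mulr1.
by rewrite scale1r subrr nrm0 mulr0.
Qed.

(** Boundedness ensures that, for almost every time, the slices are the actual functions and not the
    default 0, so that slicing is linear. *)
Lemma reaches_combination T (u v : controls mu T) (a b r s : R) (w w' : L2 mu) :
  ctrl_bounded L u a -> ctrl_bounded L v b -> reaches u w -> reaches v w' ->
  reaches (r *: u + s *: v) (r *: w + s *: w').
Proof.
move=> ua vb uw vw; apply: is_bochner_congr (is_bochner_lin r s uw vw).
have := ae_time_measure T; apply: filterS3 ua vb => t [ua _] [vb _] /andP[t0 tT].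
have Tt : 0 <= T - t by lra.
have uvE : slice (r *: u + s *: v) t = r *: slice u t + s *: slice v t.
  apply/LfuneqP => x.
  rewrite (@sliceE _ _ _ _ _ _ _ (`|r| * a + `|s| * b)).
    rewrite L2addE !L2scaleE (ctrl_bounded_slice ua) (ctrl_bounded_slice vb).
    by [].
  apply: filterS2 ua vb => y /andP[u0 ua] /andP[v0 vb].
  change (`|r * u (t, y) + s * v (t, y)| <= `|r| * a + `|s| * b)%R.
  rewrite (le_trans (ler_normD _ _))// !normrM.
  by apply: lerD; apply: ler_wpM2l => //; rewrite ger0_norm.
rewrite uvE; apply: L2eq_sym; apply: L2eq_trans (C0_linear S_C0 _ _ _ Tt) _.
by apply: L2eqD; [exact: L2eq_refl|exact: semigroupZ].
Qed.

(** The control is [f / dl] on the last [dl] units of time, [f] being a bounded approximation of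
    [yf]. As [dl] depends on [dl1] and not on [T], the bound [b] is uniform in the horizon. *)
Lemma approximately_reachable (yf : L2 mu) (e dl1 : R) :
  L2nneg yf -> 0 < e -> 0 < dl1 ->
  exists2 b, 0 <= b & forall T, dl1 <= T ->
    exists (u : controls mu T) (w : L2 mu),
    [/\ ctrl_bounded L u b, reaches u w & nrm (w - yf) <= e].
Proof.
move=> yf0 e0 dl10; have e2 : 0 < e / 2 by exact: divr_gt0.
have [f [B [Bge0 fB fy]]] := L2nneg_bounded_approx yf0 e2.
have [r r0 rP] := semigroup_cvg0 S_C0 f e2.
pose dl := Num.min r dl1.
have dl0 : 0 < dl by rewrite lt_min r0.
have B0 : 0 <= dl^-1 * B.
  by rewrite mulr_ge0// invr_ge0 ltW.
(* The control is at most [dl^-1 * B]; the summand 1 accounts for the sup norm and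
   [fine (mu setT) * c] for the scaled L^1 norm. *)
have b0 : 0 <= dl^-1 * B * (1 + fine (mu setT) * c).
  by rewrite mulr_ge0// addr_ge0// mulr_ge0 ?fine_ge0// ctrl_scale_ge0.
exists (dl^-1 * B * (1 + fine (mu setT) * c)) => // T dl1T.
have dlT : dl <= T by rewrite (le_trans _ dl1T)// ge_min lexx orbT.
pose E : set (measurableTypeR R) := [set` `]T - dl, T[].
pose v (z : measurableTypeR R * X) : R := \1_E z.1 * (dl^-1 * f z.2).
have mv : measurable_fun setT v.
  have mE : measurable E by exact: measurable_itv.
  apply: measurable_funM.
    by apply: (@measurableT_comp _ _ _ _ _ _ (\1_E : measurableTypeR R -> R)) => //.
  by apply: measurable_funM => //; exact: measurableT_comp.
have vB z : 0 <= v z <= dl^-1 * B.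
  have /andP[f0 fB'] := fB z.2; have dl'0 : 0 <= dl^-1 by rewrite invr_ge0 ltW.
  rewrite /v indicE; case: (_ \in _) => /=; last by rewrite mul0r lexx.
  by rewrite mul1r mulr_ge0//= ler_wpM2l.
have [u uE] : exists u : controls mu T, u = v :> (_ -> R).
  apply: (@ctrl_of_bounded _ _ _ _ _ _ (dl^-1 * B) mv).
  apply: nearW => t; apply: nearW => x; have /andP[v0 vB'] := vB (t, x).
  by rewrite ger0_norm.
have rdl : dl <= r by rewrite ge_min lexx.
have [w [bw wf]] := is_bochner_orbit S_C0 dl0 dlT
  (fun t t0 tdl => rP t t0 (le_trans tdl rdl)).
exists u, (dl^-1 *: w); split.
- apply: nearW => t; split.
    apply: nearW => x; rewrite uE; have /andP[-> /= v1] := vB (t, x).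
    rewrite (le_trans v1)// ler_peMr// lerDl mulr_ge0 ?fine_ge0// ctrl_scale_ge0.
    by [].
  apply: (@le_trans _ _ ((dl^-1 * B * fine (mu setT))%:E * c%:E)%E).
    apply: lee_wpmul2r; first by rewrite lee_fin ctrl_scale_ge0.
    rewrite uE Lnorm1 EFinM fineK; last exact: fin_num_measure.
    rewrite -integral_cst//; apply: ge0_le_integral => //.
    + apply/measurable_EFinP; apply: measurableT_comp => //.
      exact: measurable_slice.
    + by move=> x _ /=; have /andP[v0 v1] := vB (t, x); rewrite ger0_norm.
  by rewrite -EFinM lee_fin mulrDr mulr1 mulrA lerDr.
- have := is_bochner_lin dl^-1 0 bw bw; rewrite scale0r addr0.
  apply: is_bochner_congr.
  have := ae_time_measure T; apply: filterS => t /andP[t0 tT].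
  have Tt : 0 <= T - (t : R) by lra.
  rewrite scale0r addr0 scalerA.
  rewrite (_ : slice u t = (dl^-1 * \1_E t) *: f).
    exact: L2eq_sym (semigroupZ S_C0 _ _ Tt).
  apply/LfuneqP => x; rewrite (@sliceE _ _ _ _ _ _ _ (dl^-1 * B)).
    by rewrite uE L2scaleE /v /= mulrA [\1_E t * _]mulrC.
  apply: nearW => y; rewrite uE; have /andP[v0 vB'] := vB (t, y).
  by rewrite ger0_norm.
- rewrite (le_trans (nrm_triangle f _ _))// [leRHS]splitr.
  exact: lerD.
Qed.

End reachability.

Lemma ereal_real_between (R : realType) (x : R) (m : \bar R) : (x%:E < m)%E ->
  exists2 y : R, x < y & (y%:E < m)%E.
Proof.
case: m => [r| |//]; last by exists (x + 1); rewrite ?ltrDl ?ltry.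
by rewrite lte_fin => xr; exists ((x + r) / 2); rewrite ?lte_fin; lra.
Qed.

(** * Continuity of the value function *)

Section minimal_time.
Context (R : realType) d (X : measurableType d).
Variable mu : {finite_measure set X -> \bar R}.
Context (S Sadj : R -> L2 mu -> L2 mu) (S_C0 : C0_semigroup S).
Context (S_adj : forall t : R, 0 <= t -> adjoint (S t) (Sadj t)).
Context (Sadj_pos : comparison_principle Sadj).
Context (L eps : R) (L_gt0 : 0 < L) (eps_gt0 : 0 < eps).
Context (yf : L2 mu) (yf_ge0 : L2nneg yf) (yf_gt : eps < nrm yf).
Local Notation Pi := (value S L eps yf).
Local Notation Tst := (Tstar S L eps yf).

Lemma value_ltP T (l : \bar R) : (Pi T < l)%E ->
  exists2 u : controls mu T, feasible S eps yf u & (FT L u < l)%E.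
Proof. by move=> /ereal_inf_lt[_ [u fu <-] ul]; exists u. Qed.

Lemma value_le T (u : controls mu T) : feasible S eps yf u -> (Pi T <= FT L u)%E.
Proof. by move=> fu; apply: ereal_inf_lbound; exists u. Qed.

Lemma Tstar_le T (u : controls mu T) (l : \bar R) : 0 < T ->
  feasible S eps yf u -> (FT L u <= l)%E -> (Tst l <= T%:E)%E.
Proof.
move=> T0 fu ul; apply: ereal_inf_lbound; exists T => //; split => //.
by exists u.
Qed.

Lemma Tstar_value Tl T : is_Tell S L eps yf Tl -> 0 < T -> (T%:E < Tl)%E ->
  Tst (Pi T) = T%:E.
Proof.
move=> [Tl0 dec _] T0 TTl; apply/eqP; rewrite eq_le; apply/andP; split.
  rewrite leNgt; apply/negP => Tlt.
  (* A horizon strictly between [T] and both [Tst (Pi T)] and [Tl] has value below [Pi T], hence a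
     control that contradicts the definition of [Tst]. *)
  have [T1 [TT1 T1T T1Tl]] : exists T1 : R,
      [/\ T < T1, (T1%:E < Tst (Pi T))%E & (T1%:E < Tl)%E].
    have [T1 TT1] : exists2 T1 : R, T < T1 & (T1%:E < mine (Tst (Pi T)) Tl)%E.
      by apply: ereal_real_between; rewrite lt_min Tlt.
    by rewrite lt_min => /andP[? ?]; exists T1.
  have [u fu ul] := value_ltP (dec _ _ T0 TT1 T1Tl).
  have := Tstar_le (lt_trans T0 TT1) fu (ltW ul).
  by rewrite leNgt T1T.
apply: le_ereal_inf_tmp => _ [T1 [T10 [u [fu ul]]] <-].
rewrite lee_fin leNgt; apply/negP => T1T.
have := dec _ _ T10 T1T TTl; apply/negP; rewrite -leNgt.
exact: le_trans (value_le fu) ul.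
Qed.

Lemma optimal_minimal_time Tl T (u : controls mu T) :
  is_Tell S L eps yf Tl -> 0 < T -> (T%:E < Tl)%E ->
  optimal S L eps yf u -> minimal_time_control S L eps yf (Pi T) u.
Proof.
move=> tell T0 TTl [fu uE]; split => //; first by rewrite uE.
exact: Tstar_value tell T0 TTl.
Qed.

(** The value function is nonincreasing from some horizon on, so its limit at infinity is an
    infimum, and a common lower bound [l] of all values would bound it from below. *)
Lemma ex_value_lt Tl (l : R) : is_Tell S L eps yf Tl ->
  (mu_minus S L eps yf < l%:E)%E -> exists2 T, 0 < T & (Pi T < l%:E)%E.
Proof.
move=> [Tl0 dec cst] ml; apply: contrapT => nex.
have lv T : 0 < T -> (l%:E <= Pi T)%E.
  by move=> T0; rewrite leNgt; apply/negP => h; apply: nex; exists T.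
have [k k0 kP] : exists2 k : R, 0 < k &
    forall s t, k <= s -> s <= t -> (Pi t <= Pi s)%E.
  case: Tl Tl0 dec cst => [r|_|//].
    rewrite lte_fin => r0 _ cst; exists r => // s t rs st.
    by rewrite (cst s t)// lee_fin// (le_trans rs).
  move=> dec _; exists 1 => // s t s1; rewrite le_eqVlt => /predU1P[->//|st].
  by apply/ltW/dec => //; [exact: lt_le_trans s1|exact: ltry].
(* Freezing [Pi] before [k] gives a function monotone on the whole line with the same limit. *)
pose g T := Pi (Num.max T k).
have gP : {homo g : s t / s <= t >-> (t <= s)%E}.
  move=> s t st; apply: kP; first by rewrite le_max lexx orbT.
  by rewrite ge_max !le_max st lexx orbT.
have gcvg := nonincreasing_cvge gP.
have vcvg : Pi T @[T --> +oo] --> ereal_inf (range g).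
  apply: cvg_trans gcvg; apply: near_eq_cvg.
  exists k; split; first exact: num_real.
  by move=> T kT; rewrite /g max_l// ltW.
move: ml; rewrite /mu_minus (cvg_lim _ vcvg)//; apply/negP; rewrite -leNgt.
apply: le_ereal_inf_tmp => _ [T _ <-]; apply: lv.
by rewrite lt_max k0 orbT.
Qed.

(** The order of quantifiers matters: [b] depends on [t] alone, so the extra cost vanishes with
    [th], while [r] may depend on [a] and [th]. The lemma serves to come down to [t] from longer
    horizons and to go slightly below [t]. *)
Lemma small_perturbation t : 0 < t ->
  exists2 b, 0 <= b & forall a th, 0 <= a -> 0 < th -> th <= 1 ->
  exists2 r, 0 < r & forall T T' (u : controls mu T),
    t / 2 <= T' -> T' <= T -> T <= t + 1 -> T <= T' + r ->
    feasible S eps yf u -> ctrl_bounded L u a ->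
    exists2 v : controls mu T', feasible S eps yf v &
      (FT L v <= ((a + th * b) ^+ 2 / 2)%:E)%E.
Proof.
move=> t0; have t20 : 0 < t / 2 by exact: divr_gt0.
have e20 : 0 < eps / 2 by exact: divr_gt0.
have [b b0 bP] := approximately_reachable S_C0 L_gt0 yf_ge0 e20 t20.
have [one oneE] := L2_cst_exists mu 1.
have [C C0 CP] := semigroup_locally_bounded S_C0 one (t + 1).
exists b => // a th a0 th0 th1.
have aC0 : 0 <= a * C by exact: mulr_ge0.
(* With this [r] truncation moves the state by at most [th * (eps / 2)]. *)
exists (th * (eps / 2) / (a * C + 1)).
  by rewrite divr_gt0 ?mulr_gt0// ltr_wpDl.
move=> T T' u tT' T'T Tt Tr /(feasibleP _ _ yf_gt)[w uw wy] ua.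
have := reaches_truncate S_C0 S_adj Sadj_pos oneE a0 C0 (_ : 0 <= T - T')
  (_ : T - T' <= T) Tt CP ua uw.
have -> : T - (T - T') = T' by ring.
case=> [||v [w1 [va vw1 w1w]]]; [by rewrite subr_ge0|lra|].
have [v2 [w2 [v2b v2w2 w2y]]] := bP T' tT'.
have th1' : 0 <= 1 - th by rewrite subr_ge0.
exists ((1 - th) *: v + th *: v2).
  apply/(feasibleP _ _ yf_gt); exists ((1 - th) *: w1 + th *: w2).
    exact: reaches_combination va v2b vw1 v2w2.
  have -> : (1 - th) *: w1 + th *: w2 - yf =
      (1 - th) *: (w1 - yf) + th *: (w2 - yf).
    rewrite !scalerBr addrACA -opprD -scalerDl subrK scale1r//.
  rewrite (le_trans (nrmD _ _))// !nrmZ !ger0_norm ?(ltW th0)//.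
  have h1 : nrm (w1 - yf) <= eps + th * (eps / 2).
    rewrite (le_trans (nrm_triangle w _ _))// addrC lerD//.
    rewrite (le_trans w1w)// (le_trans (_ : _ <= a * C * (th * (eps / 2) / (a * C + 1))))//.
      by rewrite ler_wpM2l// lerBlDl.
    rewrite mulrA ler_pdivrMr ?ltr_wpDl// mulrC ler_wpM2l// ?lerDl//.
    by rewrite mulr_ge0 ?ltW.
  have h2 := ler_wpM2l th1' h1; have h3 := ler_wpM2l (ltW th0) w2y.
  (* The sum of the two bounds is [eps - th * th * eps / 2]. *)
  apply: le_trans (lerD h2 h3) _.
  have : 0 <= th * th * eps by rewrite !mulr_ge0 ?ltW.
  lra.
have th0' := ltW th0.
have ab0 : 0 <= (1 - th) * a + th * b by rewrite addr_ge0 ?mulr_ge0.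
have xb := ctrl_bounded_convex th1' th0' va v2b (ctrl_scale_ge0 _ L_gt0).
apply: le_trans (bounded_FT_le ab0 xb) _.
rewrite lee_fin ler_pM2r ?invr_gt0// ler_pXn2r// ?nnegrE ?addr_ge0 ?mulr_ge0//.
by rewrite lerD2r ler_piMl// lerBlDr lerDl.
Qed.

(** A feasible state has norm at least [nrm yf - eps], whereas on a horizon [T <= 1] the reachable
    states have norm at most [a * C * T]. *)
Lemma Tstar_lower_bound (l : R) : exists2 r, 0 < r &
  forall T (u : controls mu T), 0 < T -> feasible S eps yf u ->
    (FT L u <= l%:E)%E -> r <= T.
Proof.
have [one oneE] := L2_cst_exists mu 1.
have [C C0 CP] := semigroup_locally_bounded S_C0 one 1.
set a := Num.sqrt (2 * l); have a0 : 0 <= a := sqrtr_ge0 _.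
have aC0 : 0 <= a * C by exact: mulr_ge0.
have aC1 : 0 < a * C + 1 by rewrite ltr_wpDl.
exists (Num.min 1 ((nrm yf - eps) / (a * C + 1))).
  by rewrite lt_min ltr01 divr_gt0// subr_gt0.
move=> T u T0 /(feasibleP _ _ yf_gt)[w uw wy] ul.
have [T1|/ltW T1] := leP T 1; last by rewrite ge_min T1.
have [l0 ua] := FT_le_bounded T0 ul.
rewrite ge_min; apply/orP; right.
have := reaches_small S_C0 S_adj Sadj_pos oneE a0 C0 (ltW T0) T1 CP ua uw.
have := nrm_le_sub yf w; rewrite nrmB => h1 h2.
rewrite ler_pdivrMr// mulrDr mulr1 [T * _]mulrC; lra.
Qed.

Lemma value_Tstar Tl (l : R) : is_Tell S L eps yf Tl ->
  (mu_minus S L eps yf < l%:E)%E ->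
  exists T, [/\ 0 < T, Tst l%:E = T%:E & Pi T = l%:E].
Proof.
move=> tell ml; have [T1 T10 /value_ltP[u1 fu1 /ltW ul1]] := ex_value_lt tell ml.
have TstT1 := Tstar_le T10 fu1 ul1.
have [l0 _] := FT_le_bounded T10 ul1.
have [r r0 rP] := Tstar_lower_bound l.
have rTst : (r%:E <= Tst l%:E)%E.
  apply: le_ereal_inf_tmp => _ [T [T0 [u [fu ul]]] <-].
  by rewrite lee_fin; exact: rP fu ul.
have [t tE] : exists t, Tst l%:E = t%:E.
  by case: (Tst l%:E) rTst TstT1 => // t _ _; exists t.
have t0 : 0 < t by rewrite (lt_le_trans r0)// -lee_fin -tE.
exists t; split => //.
have [b b0 bP] := small_perturbation t0.
set a := Num.sqrt (2 * l); have a0 : 0 <= a := sqrtr_ge0 _.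
have aE : a ^+ 2 = 2 * l by rewrite sqr_sqrtr// mulr_ge0.
apply/eqP; rewrite eq_le; apply/andP; split.
  (* Upper bound: controls of cost at most [l] exist on horizons just above [t]; shortened to [t],
     they cost at most [l + e]. *)
  apply/lee_addgt0Pr => e e0.
  have k0 : 0 < a * b + b ^+ 2 + 1 by rewrite ltr_wpDl// addr_ge0 ?mulr_ge0.
  pose th := Num.min 1 (e / (a * b + b ^+ 2 + 1)).
  have th0 : 0 < th by rewrite lt_min ltr01 divr_gt0.
  have th1 : th <= 1 by rewrite ge_min lexx.
  have the : th * (a * b + b ^+ 2 + 1) <= e.
    by rewrite -ler_pdivlMr// ge_min lexx orbT.
  have [q q0 qP] := bP a th a0 th0 th1.
  have : (Tst l%:E < (t + Num.min q 1)%:E)%E.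
    by rewrite tE lte_fin ltrDl lt_min q0 ltr01.
  move=> /ereal_inf_lt[_ [T [T0 [u [fu ul]]] <-]]; rewrite lte_fin => TtP.
  have tT : t <= T by rewrite -lee_fin -tE; exact: Tstar_le fu ul.
  have [Tq T1'] : T <= t + q /\ T <= t + 1.
    by split; rewrite (le_trans (ltW TtP))// lerD2l ge_min lexx ?orbT.
  have [_ ua] := FT_le_bounded T0 ul.
  have [|v fv vl] := qP T t u _ tT T1' Tq fu ua; first lra.
  apply: (le_trans (value_le fv)); apply: (le_trans vl).
  rewrite -EFinD lee_fin.
  have -> : (a + th * b) ^+ 2 / 2 =
      a ^+ 2 / 2 + th * (a * b) + th * (th * (b ^+ 2 / 2)).
    by field.
  rewrite aE -addrA; have -> : 2 * l / 2 = l by field.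
  rewrite lerD2l; apply: le_trans the.
  have b20 : 0 <= b ^+ 2 by rewrite sqr_ge0.
  have h : th * (b ^+ 2 / 2) <= b ^+ 2.
    apply: (@le_trans _ _ (1 * (b ^+ 2 / 2))); last lra.
    by apply: ler_wpM2r => //; lra.
  by rewrite -mulrDr ler_pM2l//; lra.
(* Lower bound: a control on [t] of cost below [l] leaves room to shorten the horizon while keeping
   the cost at most [l], against the minimality of [t]. *)
rewrite leNgt; apply/negP => /value_ltP[u fu ul].
have uE : FT L u = (fine (FT L u))%:E.
  by rewrite fineK// ge0_fin_numE ?(lt_trans ul) ?ltry//; exact: FT_ge0.
set l' := fine _ in uE.
have ul' : (FT L u <= l'%:E)%E by rewrite -uE.
have [l'0 ua] := FT_le_bounded t0 ul'.
set a' := Num.sqrt (2 * l') in ua; have a'0 : 0 <= a' := sqrtr_ge0 _.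
have ll : l' < l by rewrite -lte_fin -uE.
have aa' : a' < a by rewrite ltr_sqrt; lra.
have b1 : 0 < b + 1 by rewrite ltr_wpDl.
(* This weight keeps the new amplitude [a' + th * b] at most [a]. *)
pose th := Num.min 1 ((a - a') / (b + 1)).
have th0 : 0 < th by rewrite lt_min ltr01 divr_gt0// subr_gt0.
have th1 : th <= 1 by rewrite ge_min lexx.
have tha : th * (b + 1) <= a - a'.
  by rewrite -ler_pdivlMr// ge_min lexx orbT.
have [q q0 qP] := bP a' th a'0 th0 th1.
pose T' := Num.max (t / 2) (t - q).
have T't : T' < t by rewrite gt_max; apply/andP; split; lra.
have T'0 : 0 < T' by rewrite lt_max divr_gt0.
have [|||v fv vl] := qP t T' u _ (ltW T't) _ _ fu ua.
- by rewrite le_max lexx.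
- by rewrite lerDl.
- by rewrite -lerBlDr le_max lexx orbT.
have vlt : (FT L v <= l%:E)%E.
  apply: (le_trans vl); rewrite lee_fin.
  have -> : l = a ^+ 2 / 2 by rewrite aE; field.
  have tb0 : 0 <= th * b by rewrite mulr_ge0// ltW.
  rewrite ler_pM2r ?invr_gt0// ler_pXn2r// ?nnegrE ?addr_ge0//.
  by move: tha; rewrite mulrDr mulr1; lra.
by have := Tstar_le T'0 fv vlt; rewrite tE lee_fin leNgt T't.
Qed.

End minimal_time.

Theorem proposition5p10 (R : realType) (d : nat) (Omega : set 'rV[R]_d)
    (Omega_neq0 : Omega !=set0) (Omega_open : open Omega)
    (Omega_fin : (lebesgue_rV R d Omega < +oo)%E)
    (L eps : R) (L_gt0 : 0 < L) (L_lt1 : L < 1) (eps_gt0 : 0 < eps) :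
  let mu := lebesgue_on Omega_open Omega_fin in
  forall (A : L2 mu -> L2 mu -> Prop) (S Sadj : R -> L2 mu -> L2 mu)
    (A_generates : generates A S)
    (S_adjoint : forall t : R, 0 <= t -> adjoint (S t) (Sadj t))
    (Sadj_comparison : comparison_principle Sadj)
    (yf : L2 mu) (yf_ge0 : L2nneg yf) (yf_gt : (eps%:E < L2norm yf)%E)
    (Tl : \bar R) (Tl_def : is_Tell S L eps yf Tl),
  (forall T : R, 0 < T -> (T%:E < Tl)%E ->
     (forall u : controls mu T, optimal S L eps yf u ->
        minimal_time_control S L eps yf (value S L eps yf T) u) /\
     Tstar S L eps yf (value S L eps yf T) = T%:E) /\
  (forall lambda : R, (mu_minus S L eps yf < lambda%:E)%E ->
     exists T : R, [/\ 0 < T, Tstar S L eps yf lambda%:E = T%:E &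
       value S L eps yf T = lambda%:E]).
Proof.
move=> mu A S Sadj [S_C0 _] S_adj Sadj_pos yf yf_ge0 yf_gt Tl tell.
have yf_gt' : eps < nrm yf by rewrite -lte_fin -L2normE.
split=> [T T0 TTl|l ml].
  split; last exact: Tstar_value tell T0 TTl.
  by move=> u; exact: optimal_minimal_time tell T0 TTl.
exact: (value_Tstar S_C0 S_adj Sadj_pos L_gt0 eps_gt0 yf_ge0 yf_gt' tell ml).
Qed.
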